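(* Let $D \subset \mathbb{R}^d$ be a domain and let $\mathcal{G}_\theta: H^t(D) \to H^t(D)$ be a neural operator that is a contraction mapping on $H^t(D)$ with contraction constant $0 < q < 1$, i.e. $\|\mathcal{G}_\theta(u) - \mathcal{G}_\theta(v)\|_{H^t(D)} \le q\|u - v\|_{H^t(D)}$ for all $u, v \in H^t(D)$. Then, for any $u \in H^t(D)$, the iterated application $\mathcal{G}_\theta^n(u)$ converges exponentially to the fixed point $u^*$ of $\mathcal{G}_\theta$: for every $n$, $$\| \mathcal{G}_\theta^n(u) - u^* \|_{H^t(D)} \leq q^n \| u - u^* \|_{H^t(D)}.$$
   Context: For a domain $D \subset \mathbb{R}^d$ and $t \ge 0$, the Sobolev space $H^t(D)$ consists of functions $u: D \to \mathbb{R}$ whose weak derivatives up to order $t$ are square-integrable, with norm $\|u\|_{H^t(D)} = \left(\sum_{|\alpha| \le t} \int_D |D^\alpha u(x)|^2\,dx\right)^{1/2}$, where $\alpha$ is a multi-index and $D^\alpha$ is the weak derivative of order $\alpha$. A neural operator $\mathcal{G}_\theta: U \to V$ between Banach spaces of functions over $D$ is a parameterized mapping, with parameters $\theta$ (designed to approximate a target operator $\mathcal{T}: U \to V$). Here $U = V = H^t(D)$, and $\mathcal{G}_\theta^n$ denotes the $n$-fold composition of $\mathcal{G}_\theta$ with itself. *)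

(* Defs.v *)
From HB Require Import structures.
From mathcomp Require Import all_boot all_order all_algebra.
From mathcomp Require Import all_classical all_reals all_analysis.

Set Implicit Arguments.
Unset Strict Implicit.
Unset Printing Implicit Defensive.

Import Order.TTheory GRing.Theory Num.Theory.
Import numFieldNormedType.Exports.

Local Open Scope classical_set_scope.
Local Open Scope ring_scope.

Definition measure_rV_display : measure_display.
Proof. exact: default_measure_display. Qed.

Section measurable_rV.
Context {R : realType} (n : nat).

Let coors : 'I_n -> 'rV[R]_n -> R := fun i x => x ord0 i.

Let rV_set0 : g_sigma_preimage coors set0.
Proof. exact: sigma_algebra0. Qed.

Let rV_setC A : g_sigma_preimage coors A -> g_sigma_preimage coors (~` A).
Proof. exact: sigma_algebraC. Qed.

Let rV_bigcup (F : (set 'rV[R]_n)^nat) : (forall i, g_sigma_preimage coors (F i)) ->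
  g_sigma_preimage coors (\bigcup_i (F i)).
Proof. exact: sigma_algebra_bigcup. Qed.

HB.instance Definition _ := @isMeasurable.Build measure_rV_display
  'rV[R]_n (g_sigma_preimage coors) rV_set0 rV_setC rV_bigcup.

End measurable_rV.

Section measurable_rV_theory.
Context {R : realType}.

Lemma measurable_coord n (i : 'I_n) :
  measurable_fun [set: 'rV[R]_n] (fun x : 'rV[R]_n => x ord0 i).
Proof.
move=> _ Y mY; rewrite setTI; apply: sub_sigma_algebra => /=.
rewrite -bigcup_seq/=; exists i => /=; first by rewrite mem_index_enum.
by exists Y => //; rewrite setTI.
Qed.

Lemma measurable_fun_rV d (T : measurableType d) n (f : T -> 'rV[R]_n) :
  (forall i, measurable_fun [set: T] (fun t => f t ord0 i)) ->
  measurable_fun [set: T] f.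
Proof.
move=> mf; move=> _ Y; move: Y.
pose C := [set Y : set 'rV[R]_n | measurable (f @^-1` Y)].
suff sub : @measurable _ 'rV[R]_n `<=` C.
  by move=> Y mY; rewrite setTI; exact: sub.
apply: smallest_sub.
  split; rewrite /C/=.
  - by rewrite preimage_set0.
  - by move=> A mA; rewrite setTD preimage_setC; exact: measurableC.
  - by move=> F mF; rewrite preimage_bigcup; exact: bigcup_measurable.
move=> A; rewrite -bigcup_seq/= => -[i _ [B mB <-]].
rewrite /C/= setTI -[X in measurable X]setTI; exact: mf.
Qed.

Lemma open_measurable_rV n (U : set 'rV[R]_n) : open U -> measurable U.
Proof.
move=> oU.
pose box (q : 'rV[rat]_n * 'rV[rat]_n) : set 'rV[R]_n :=
  [set x | forall i, ratr (q.1 ord0 i) < x ord0 i < ratr (q.2 ord0 i)].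
have mbox q : measurable (box q).
  have -> : box q = \bigcap_(i in [set: 'I_n])
      ((fun x : 'rV[R]_n => x ord0 i) @^-1`
         `]ratr (q.1 ord0 i), ratr (q.2 ord0 i)[%classic).
    apply/seteqP; split => [x bx i _ /=|x bx i]; first by rewrite in_itv/= bx.
    by have := bx i I; rewrite /= in_itv.
  apply: fin_bigcap_measurable; first exact: finite_finset.
  by move=> i _; rewrite -[X in measurable X]setTI; exact: measurable_coord.
pose F k := if unpickle k is Some q then
  if `[< box q `<=` U >] then box q else set0 else set0.
have -> : U = \bigcup_k F k.
  apply/seteqP; split => [x Ux|x [k _]]; last first.
    by rewrite /F; case: unpickle => // q; case: asboolP => // qU; exact: qU.
  have [e /= e0 xeU] : exists2 e : R, 0 < e & ball x e `<=` U.
    have /nbhs_ballP[e /= e0 xeU] : nbhs x U by exact: open_nbhs_nbhs.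
    by exists e.
  have ratP (y z : R) : y < z -> exists q : rat, y < ratr q < z.
    by move=> /rat_in_itvoo[q]; rewrite in_itv; exists q.
  have /choice[a aP] : forall i, exists q : rat, x ord0 i - e < ratr q < x ord0 i.
    by move=> i; apply: ratP; rewrite ltrBlDr ltrDl.
  have /choice[b bP] : forall i, exists q : rat, x ord0 i < ratr q < x ord0 i + e.
    by move=> i; apply: ratP; rewrite ltrDl.
  pose q := (\row_i a i, \row_i b i).
  exists (pickle q) => //; rewrite /F pickleK; case: asboolP => [_|].
    move=> i /=; rewrite !mxE.
    by have /andP[_ ->] := aP i; have /andP[-> _] := bP i.
  case; move=> y /= yab; apply: xeU; split => // i j; rewrite ord1.
  have := yab j; rewrite !mxE => /andP[y1 y2].
  have /andP[a1 _] := aP j; have /andP[_ b2] := bP j.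
  rewrite /ball/= ltr_distlC; apply/andP; split; first exact: lt_trans a1 y1.
  exact: lt_trans y2 b2.
apply: bigcup_measurable => k _; rewrite /F; case: unpickle => // q.
by case: asboolP.
Qed.

End measurable_rV_theory.

Section lebesgue_rV.
Context {R : realType}.

Definition cons_rV n (xy : measurableTypeR R * 'rV[R]_n) : 'rV[R]_n.+1 :=
  row_mx (const_mx xy.1 : 'rV[R]_1) xy.2.

Let uncons_rV n (z : 'rV[R]_n.+1) : measurableTypeR R * 'rV[R]_n :=
  (z ord0 ord0, \row_i z ord0 (lift ord0 i)).

Lemma cons_rV0 n (xy : measurableTypeR R * 'rV[R]_n) :
  cons_rV xy ord0 ord0 = xy.1.
Proof.
have := row_mxEl (const_mx xy.1 : 'rV[R]_1) xy.2 ord0 ord0.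
by rewrite [RHS]mxE => <-; rewrite /cons_rV; congr (row_mx _ _ _ _); exact/val_inj.
Qed.

Lemma cons_rVS n (xy : measurableTypeR R * 'rV[R]_n) i :
  cons_rV xy ord0 (lift ord0 i) = xy.2 ord0 i.
Proof.
have <- := row_mxEr (const_mx xy.1 : 'rV[R]_1) xy.2 ord0 i.
by rewrite /cons_rV; congr (row_mx _ _ _ _); exact/val_inj.
Qed.

Let cons_rVK n : cancel (@cons_rV n) (@uncons_rV n).
Proof.
move=> [x y]; rewrite /uncons_rV cons_rV0; congr pair.
by apply/rowP => i; rewrite mxE cons_rVS.
Qed.

Lemma measurable_cons_rV n : measurable_fun [set: _] (@cons_rV n).
Proof.
apply: measurable_fun_rV => i; have [j ->|->] := unliftP ord0 i.
  under eq_fun do rewrite cons_rVS.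
  exact: (measurableT_comp (measurable_coord j) measurable_snd).
under eq_fun do rewrite cons_rV0.
exact: measurable_fst.
Qed.

Let measurable_uncons_rV n : measurable_fun [set: _] (@uncons_rV n).
Proof.
apply: measurable_fun_pair; first exact: measurable_coord.
apply: measurable_fun_rV => i; under eq_fun do rewrite mxE.
exact: measurable_coord.
Qed.

Section step.
Variables (n : nat) (mu : {sigma_finite_measure set 'rV[R]_n -> \bar R}).

Definition lebesgue_rV_step : set 'rV[R]_n.+1 -> \bar R :=
  pushforward (lebesgue_measure \x mu)%E (@cons_rV n).

Let step0 : lebesgue_rV_step set0 = 0%E.
Proof. by rewrite /lebesgue_rV_step /pushforward preimage_set0 measure0. Qed.

Let step_ge0 A : (0 <= lebesgue_rV_step A)%E.
Proof. by rewrite /lebesgue_rV_step /pushforward measure_ge0. Qed.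

Let step_sigma_additive : semi_sigma_additive lebesgue_rV_step.
Proof.
move=> F mF tF mUF; rewrite /lebesgue_rV_step /pushforward preimage_bigcup.
have mpre A : measurable A -> measurable (@cons_rV n @^-1` A).
  by move=> mA; rewrite -[X in measurable X]setTI; exact: measurable_cons_rV.
apply: measure_semi_sigma_additive; first by move=> k; exact: mpre.
- apply/trivIsetP => /= i j _ _ ij; rewrite -preimage_setI.
  by move/trivIsetP : tF => /(_ _ _ _ _ ij) ->//; rewrite preimage_set0.
- by rewrite -preimage_bigcup; exact: mpre.
Qed.

HB.instance Definition _ := isMeasure.Build _ _ _ lebesgue_rV_step
  step0 step_ge0 step_sigma_additive.

Let step_sigma_finite : sigma_finite setT lebesgue_rV_step.
Proof.
have /sigma_finiteP[F [TF ndF Foo]] :=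
  sigma_finiteT (lebesgue_measure : {sigma_finite_measure set _ -> \bar R}).
have /sigma_finiteP[G [TG ndG Goo]] := sigma_finiteT mu.
exists (fun k => @uncons_rV n @^-1` (F k `*` G k)).
  apply/esym; rewrite -subTset => z _.
  have [i _ Fi] : (\bigcup_i F i) (uncons_rV z).1 by rewrite -TF.
  have [j _ Gj] : (\bigcup_i G i) (uncons_rV z).2 by rewrite -TG.
  exists (maxn i j) => //; split.
    by move: Fi; apply/subsetPset/ndF/leq_maxl.
  by move: Gj; apply/subsetPset/ndG/leq_maxr.
move=> k; have [mFk Fkoo] := Foo k; have [mGk Gkoo] := Goo k; split.
  rewrite -[X in measurable X]setTI; apply: measurable_uncons_rV => //.
  exact: measurableX.
rewrite /lebesgue_rV_step /pushforward.
rewrite [X in (_ X < _)%E](_ : _ = F k `*` G k); last first.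
  apply/seteqP; split => z zFG; first by rewrite -(cons_rVK z).
  by change ((F k `*` G k) (uncons_rV (cons_rV z))); rewrite cons_rVK.
by rewrite product_measure1E// lte_mul_pinfty// ge0_fin_numE.
Qed.

HB.instance Definition _ := Measure_isSigmaFinite.Build _ _ _ lebesgue_rV_step
  step_sigma_finite.

End step.

(* The d-fold product of the one-dimensional Lebesgue measure, on Borel sets;
   characterised by its values on boxes in [lebesgue_rV_box]. *)
Fixpoint lebesgue_rV (n : nat) : {sigma_finite_measure set 'rV[R]_n -> \bar R} :=
  if n is m.+1 then lebesgue_rV_step (lebesgue_rV m) else \d_(0 : 'rV[R]_0).

Lemma lebesgue_rV_box n (A : 'I_n -> set (measurableTypeR R)) :
  (forall i, measurable (A i)) ->
  lebesgue_rV n [set x | forall i, A i (x ord0 i)] =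
  (\prod_(i < n) lebesgue_measure (A i))%E.
Proof.
elim: n A => [|n ih] A mA.
  rewrite big_ord0 /= diracE mem_set//.
  by move=> [].
rewrite big_ord_recl -ih//=.
have mbox : measurable [set x : 'rV[R]_n | forall i, A (lift ord0 i) (x ord0 i)].
  have -> : [set x : 'rV[R]_n | forall i, A (lift ord0 i) (x ord0 i)] =
      \bigcap_(i in [set: 'I_n]) ((fun x : 'rV[R]_n => x ord0 i) @^-1`
                                 A (lift ord0 i)).
    by apply/seteqP; split => [x bx i _ /=|x bx i]; [exact: bx|exact: (bx i I)].
  apply: fin_bigcap_measurable; first exact: finite_finset.
  move=> i _; rewrite -[X in measurable X]setTI.
  exact: (measurable_coord i measurableT (mA (lift ord0 i))).
rewrite -product_measure1E//; congr product_measure1.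
apply/seteqP; split => [[x y]/= xyA|[x y]/= [xA yA] i].
  split=> [|i]; first by have := xyA ord0; rewrite cons_rV0.
  by have := xyA (lift ord0 i); rewrite cons_rVS.
by have [j ->|->] := unliftP ord0 i; rewrite ?cons_rVS ?cons_rV0//; exact: yA.
Qed.

End lebesgue_rV.

Section domains.
Context {R : realType} {d : nat}.

Record domain := Domain {
  domain_set :> set 'rV[R]_d ;
  domain_open : open domain_set ;
  domain_connected : connected domain_set ;
  domain_nonempty : domain_set !=set0 }.

Definition measurable_domain (D : domain) : measurable D :=
  open_measurable_rV (@domain_open D).

Definition lebesgue_on (D : domain) : {measure set 'rV[R]_d -> \bar R} :=
  mrestr (lebesgue_rV d) (measurable_domain D).

End domains.
Arguments domain : clear implicits.

Section weak_derivatives.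
Context {R : realType} {d : nat}.
Implicit Types (f u v phi : 'rV[R]_d -> R) (alpha : 'I_d -> nat).

Definition partial_derivative (i : 'I_d) f : 'rV[R]_d -> R :=
  fun x => 'D_(delta_mx 0 i) f x.

(* C^oo: all iterated partial derivatives, in any order, are differentiable
   everywhere. *)
Definition smooth f : Prop :=
  forall (s : seq 'I_d) x, differentiable (foldr partial_derivative f s) x.

Definition test_function (D : domain R d) phi : Prop :=
  let supp := closure [set x | phi x != 0] in
  [/\ smooth phi, compact supp & supp `<=` D].

Definition multi_order alpha : nat := (\sum_i alpha i)%N.

Definition multi_derivative alpha f : 'rV[R]_d -> R :=
  foldr (fun i => iter (alpha i) (partial_derivative i)) f (enum 'I_d).

Definition locally_integrable_on (D : domain R d) f : Prop :=
  measurable_fun D f /\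
  forall K : set 'rV[R]_d, compact K -> K `<=` D ->
    (lebesgue_rV d).-integrable K (EFin \o f).

Definition weak_derivative (D : domain R d) alpha u v : Prop :=
  [/\ locally_integrable_on D u, locally_integrable_on D v &
    forall phi, test_function D phi ->
      \int[lebesgue_rV d]_(x in D) (u x * multi_derivative alpha phi x) =
      (-1) ^+ multi_order alpha * \int[lebesgue_rV d]_(x in D) (v x * phi x)].

(* A representative of the weak derivative D^alpha u, which is unique up to a
   null set of D; arbitrary if u has none. *)
Definition weakD (D : domain R d) alpha u : 'rV[R]_d -> R :=
  get [set v | weak_derivative D alpha u v].

Definition square_integrable_on (D : domain R d) v : Prop :=
  (lebesgue_rV d).-integrable D (EFin \o (fun x => v x ^+ 2)).

End weak_derivatives.

Section sobolev.
Context {R : realType} {d : nat}.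

(* H^t(D), as a subtype of the quotient L^2(D): the measure [lebesgue_on D] does
   not charge the complement of D, so Leibniz equality in [sobolev t D] is
   equality almost everywhere on D, see [sobolev_eqP]. *)
Record sobolev (t : nat) (D : domain R d) := Sobolev {
  sobolev_fun :> LspaceType (lebesgue_on D) (lee1n 2) ;
  sobolev_weak_derivatives : forall alpha : 'I_d -> nat,
    (multi_order alpha <= t)%N ->
    exists2 v : 'rV[R]_d -> R, weak_derivative D alpha sobolev_fun v &
      square_integrable_on D v }.

(* A multi-index of order at most t has all its entries at most t, hence the
   finite index type. *)
Definition sobolev_norm (t : nat) (D : domain R d) (f : 'rV[R]_d -> R) : R :=
  Num.sqrt (\sum_(alpha : {ffun 'I_d -> 'I_t.+1}
                 | (multi_order (fun i => alpha i : nat) <= t)%N)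
    \int[lebesgue_rV d]_(x in D)
      (`| weakD D (fun i => alpha i : nat) f x | ^+ 2)).

Lemma sobolev_eqP (t : nat) (D : domain R d) (u v : sobolev t D) :
  u = v <-> {ae lebesgue_rV d, forall x, domain_set D x -> u x = v x}.
Proof.
split=> [->|]; first exact: aeW.
case: u v => [u wu] [v wv] /= -[N [mN N0 uvN]].
suff uv : u = v by subst v; congr Sobolev; exact: Prop_irrelevance.
have uv : u = v :> {mfun_ lebesgue_on D, 'rV[R]_d >-> measurableTypeR R}.
  rewrite -[LHS]reprK -[RHS]reprK; apply/eqP/ae_eqP.
  have mD := measurable_domain D.
  exists (N `|` ~` (D : set _)); split.
  - by apply: measurableU => //; exact: measurableC.
  - change (lebesgue_rV d ((N `|` ~` (D : set 'rV[R]_d)) `&` D) = 0%E).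
    rewrite setIUl setICl setU0; apply/eqP; rewrite eq_le measure_ge0 andbT.
    by rewrite -[leRHS]N0 le_measure ?inE//; exact: measurableI.
  - move=> x /= nuv; have [Dx|] := pselect (domain_set D x); last by right.
    by left; apply: uvN => /= uv; apply: nuv => _; exact: uv.
case: u v uv {wu wv uvN} => [u [[hu]]] [v [[hv]]] /= uv; subst v.
by congr LebesgueSpace.Pack; congr LebesgueSpace.Class; congr isFinLebesgue.Axioms_;
  exact: Prop_irrelevance.
Qed.

End sobolev.

(* Main.v *)
Require Import Defs.
From HB Require Import structures.
From mathcomp Require Import all_boot all_order all_algebra.
From mathcomp Require Import all_classical all_reals all_analysis.
From mathcomp Require Import measurable_realfun ring lra.

(** The iterates u_n = G^n(u_0) of a contraction satisfy ||u_(n+1) - u_n|| <=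
    q^n ||u_1 - u_0||, so that they converge as soon as H^t(D) is complete.
    Their limit v is a fixed point; it is the only one because a distance that
    is at most q times itself is zero; and iterating the contraction inequality
    between u and v = G(v) gives the factor q^n ([banach_fixed_point_iter]).

    What has to be established is that H^t(D) behaves as a complete metric space
    for the norm built on chosen representatives of weak derivatives. Three
    facts are needed.

    Weak derivatives are unique almost everywhere ([weak_derivative_unique]),
    hence the norm does not depend on the representatives, is compatible with
    differences, and separates points ([sobolev_norm0_eq]). This is the
    fundamental lemma of the calculus of variations ([ae_eq0_test_function]): a
    locally integrable function f that integrates to 0 against every test
    function vanishes almost everywhere. Products over the coordinates of
    exp(-1/(m(s - a))) exp(-1/(m(b - s))) are smooth, supported in a box, and
    tend to its indicator as m grows; so f has zero integral over every box
    whose closure lies in D, then over all Borel subsets of such a box by a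
    Dynkin class argument.

    The norm satisfies N(f - g)^2 <= 2 (N(f)^2 + N(g)^2) ([sobolev_normB_le]),
    which can play the part of the triangle inequality because only
    geometrically convergent sequences occur.

    Sequences with geometrically decreasing steps converge ([sobolev_complete]).
    In L^2 such a sequence converges almost everywhere, with an error at most
    s^n h for one square-integrable h ([geometric_steps_L2]). Applied to each
    weak derivative, this gives candidate limits, and h serves as the dominating
    function that lets the defining identity of weak derivatives pass to the
    limit ([weak_derivative_cvg]). *)

Set Implicit Arguments.
Unset Strict Implicit.
Unset Printing Implicit Defensive.

Import Order.TTheory GRing.Theory Num.Theory.
Import numFieldNormedType.Exports.

Local Open Scope classical_set_scope.
Local Open Scope ring_scope.

(** * Smooth functions on the line *)

Section smooth_on_the_line.
Context {R : realType}.
Implicit Types (f g : R -> R) (p : {poly R}).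

(** Differentiability is recorded by exhibiting the derivative, so that sums and
    products are handled by induction on [n] without computing limits. *)
Fixpoint n_derivable n g : Prop :=
  if n is m.+1 then
    exists2 g', (forall x : R, is_derive x 1 g (g' x)) & n_derivable m g'
  else True.

Definition smooth1 g := forall n, n_derivable n g.

Lemma n_derivableW n g : n_derivable n.+1 g -> n_derivable n g.
Proof.
elim: n g => [//|n ih] g [g' gg' ng']; exists g' => //; exact: ih.
Qed.

Lemma n_derivableD n f g :
  n_derivable n f -> n_derivable n g -> n_derivable n (f \+ g).
Proof.
elim: n f g => [//|n ih] f g [f' ff' nf'] [g' gg' ng'].
by exists (f' \+ g') => [x|]; [exact: is_deriveD|exact: ih].
Qed.

Lemma n_derivableM n f g :
  n_derivable n f -> n_derivable n g -> n_derivable n (f \* g).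
Proof.
elim: n f g => [//|n ih] f g nf ng.
move: (nf) (ng) => [f' ff' nf'] [g' gg' ng'].
exists ((f \* g') \+ (g \* f')) => [x|]; first exact: is_deriveM.
by apply: n_derivableD; apply: ih => //; exact: n_derivableW.
Qed.

Lemma smooth1M f g : smooth1 f -> smooth1 g -> smooth1 (f \* g).
Proof. by move=> sf sg n; exact: n_derivableM. Qed.

Lemma smooth1_affine (a b : R) g :
  smooth1 g -> smooth1 (fun x => g (a * x + b)).
Proof.
move=> sg n; have {sg} := sg n; elim: n g => [//|n ih] g [g' gg' ng'].
exists (cst a \* (fun x => g' (a * x + b))) => [x|].
  have aP : is_derive x (1 : R) (fun x => a * x + b) a.
    by apply: is_derive_eq; rewrite addr0; exact: mulr1.
  by apply: is_derive_eq; rewrite /= mulrC.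
apply: n_derivableM; last exact: ih.
elim: n {ih g g' gg' ng'} a => [//|n ih] a; exists (cst 0) => // x.
exact: is_derive_cst.
Qed.

Lemma smooth1_derive1 g : smooth1 g ->
  smooth1 g^`()%classic /\ forall x : R, is_derive x 1 g (g^`()%classic x).
Proof.
move=> sg.
have dg (x : R) : is_derive x 1 g (g^`()%classic x).
  have [g' /(_ x)[dgx _] _] := sg 1%N.
  by rewrite derive1E; exact: derivableP.
split=> // n; have [g' gg' ng'] := sg n.+1.
suff -> : g^`()%classic = g' by [].
by apply/funext => x; rewrite derive1E; have [_ ->] := gg' x.
Qed.

(** The functions that equal p(1/s) exp(-1/s) for s > 0 and vanish for s <= 0.
    Letting p range over all polynomials makes the family stable under
    differentiation: the derivative of [flat p] is [flat (flat_deriv p)], hence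
    all these functions are smooth, the base point 0 included. *)
Definition flat p (s : R) : R := if 0 < s then p.[s^-1] * expR (- s^-1) else 0.

Definition flat_deriv p : {poly R} := 'X^2 * (p - p^`()).

Lemma expR_ge_exprn (y : R) n : 0 <= y -> y ^+ n <= n`!%:R * expR y.
Proof.
case: n => [|n] y0; first by rewrite expr0 fact0 mul1r -expR0 ler_expR.
have := expR_ge1Dxn n y0.
rewrite -ler_pdivrMl ?ltr0n ?fact_gt0// mulrC; apply: le_trans.
by rewrite ler_wpDl.
Qed.

(** With y = 1/s, the monomial y^i of p contributes y^i exp(-y), which is at most
    (i + 2)! / y^2.  One power of s would give continuity at 0; the second one
    gives a vanishing derivative there. *)
Lemma flat_le_sqr p :
  exists2 C : R, 0 <= C & forall s, `|flat p s| <= C * s ^+ 2.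
Proof.
exists (\sum_(i < size p) `|p`_i| * (i.+2)`!%:R) => [|s].
  by apply: sumr_ge0 => i _; rewrite mulr_ge0.
rewrite /flat; case: ifPn => s0; last first.
  by rewrite normr0 mulr_ge0 ?sqr_ge0// sumr_ge0// => i _; rewrite mulr_ge0.
have y0 : 0 < s^-1 by rewrite invr_gt0.
rewrite horner_coef normrM (ger0_norm (expR_ge0 _)).
apply: (@le_trans _ _
  ((\sum_(i < size p) `|p`_i| * s^-1 ^+ i) * expR (- s^-1))).
  rewrite ler_wpM2r ?expR_ge0// (le_trans (ler_norm_sum _ _ _))//.
  apply: ler_sum => i _; rewrite normrM [X in _ * X <= _]ger0_norm//.
  by rewrite exprn_ge0// ltW.
rewrite !mulr_suml; apply: ler_sum => i _.
rewrite -!mulrA ler_wpM2l// expRN.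
rewrite ler_pdivrMr ?expR_gt0// -mulrA mulrCA mulrA.
have -> : s^-1 ^+ i = s ^+ 2 * s^-1 ^+ i.+2.
  by rewrite !exprS; field; rewrite gt_eqF.
rewrite -mulrA ler_wpM2l ?sqr_ge0//.
by apply: expR_ge_exprn; exact: ltW.
Qed.

Lemma is_derive_flat p (s : R) : is_derive s 1 (flat p) (flat (flat_deriv p) s).
Proof.
have [s0|s0|s0] := ltgtP s 0.
- rewrite {2}/flat ltNge (ltW s0)/=.
  apply: (@near_eq_is_derive _ _ _ (cst 0)) => //.
  near=> x; rewrite /flat ltNge.
  have -> // : x <= 0.
  near: x; exact: lt_le_nbhsl.
- rewrite {2}/flat s0.
  apply: (@near_eq_is_derive _ _ _
    (fun x : R => p.[x^-1] * expR (- x^-1) : R)) => //.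
    near=> x; rewrite /flat ifT//.
    near: x; exact: lt_nbhsr.
  have sn0 : s != 0 by rewrite gt_eqF.
  have dV : is_derive s 1 (fun x : R => x^-1) (- s^-2).
    apply: DeriveDef; first exact: derivableV.
    by rewrite deriveV// derive_id; exact: mulr1.
  apply: is_derive_eq; rewrite /= /flat_deriv !hornerE.
  rewrite /GRing.scale/=; by field.
- rewrite s0 {2}/flat ltxx.
  (* |flat p h / h| <= C |h|, which tends to 0. *)
  have [C C0 FC] := flat_le_sqr p.
  suff cvg0 : h^-1 *: ((flat p \o shift 0) (h *: (1 : R)) - flat p 0)
      @[h --> 0^'] --> (0 : R).
    by apply: DeriveDef; [apply/cvg_ex; exists 0|exact: cvg_lim].
  have F0 : flat p 0 = 0 by rewrite /flat ltxx.
  apply/cvgr0Pnorm_le => /= e e0; near=> h.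
  have h0 : h != 0 by near: h; exact: nbhs_dnbhs_neq.
  rewrite F0 subr0 /= addr0 normrM normfV.
  rewrite ler_pdivrMl ?normr_gt0// [X in flat p X]mulr1.
  rewrite (le_trans (FC h))// -[h ^+ 2]ger0_norm ?sqr_ge0// normrX expr2.
  rewrite mulrCA ler_wpM2l//.
  have hC : `|h| <= e / (C + 1).
    by near: h; apply: dnbhs0_le; rewrite divr_gt0// ltr_wpDl.
  rewrite (le_trans (ler_wpM2l C0 hC))// mulrA ler_pdivrMr; last first.
    by rewrite ltr_wpDl.
  by rewrite mulrC ler_wpM2l ?(ltW e0)// lerDl.
Unshelve. all: by end_near.
Qed.

Lemma smooth1_flat p : smooth1 (flat p).
Proof.
move=> n; elim: n p => [//|n ih] p; exists (flat (flat_deriv p)) => // s.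
exact: is_derive_flat.
Qed.

End smooth_on_the_line.

(** * Smooth functions in several variables *)

Section smooth_products.
Context {R : realType} {d : nat}.
Implicit Types (g : 'I_d -> R -> R) (phi : 'rV[R]_d -> R).

(** Products of functions of one coordinate each: a class that is stable under
    partial derivatives, since differentiating along the j-th axis only replaces
    the j-th factor by its derivative.  This reduces smoothness in d variables to
    smoothness on the line. *)
Definition coord_prod g : 'rV[R]_d -> R := fun x => \prod_i g i (x ord0 i).

Lemma partial_derivative_coord_prod g j :
  (forall x : R, is_derive x 1 (g j) ((g j)^`()%classic x)) ->
  partial_derivative j (coord_prod g) =
  coord_prod (fun i => if i == j then (g j)^`()%classic else g i).
Proof.
move=> gj; apply/funext => x; apply: cvg_lim => //=.
pose c := \prod_(i | i != j) g i (x ord0 i).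
have gE h : coord_prod g (h *: delta_mx 0 j + x) = g j (h + x ord0 j) * c.
  rewrite /coord_prod (bigD1 j)//= !mxE !eqxx mulr1; congr (_ * _).
  by apply: eq_bigr => i /negbTE ij; rewrite !mxE ij andbF mulr0 add0r.
have -> : coord_prod (fun i => if i == j then (g j)^`()%classic else g i) x =
    (g j)^`()%classic (x ord0 j) * c.
  rewrite /coord_prod (bigD1 j)//= eqxx; congr (_ * _).
  by apply: eq_bigr => i /negbTE ->.
rewrite [X in X @ _ --> _](_ : _ = fun h =>
    (h^-1 *: (g j (h + x ord0 j) - g j (x ord0 j))) * c); last first.
  apply/funext => h; rewrite gE -[x in coord_prod g x]add0r.
  by rewrite -(scale0r (delta_mx 0 j)) gE add0r -mulrBl scalerAl.
apply: cvgMl; have [+ _] := gj (x ord0 j).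
rewrite /derivable; under eq_fun do rewrite /= [_%:A]mulr1.
by rewrite /derive1; apply.
Qed.

Lemma differentiable_coord_prod g :
  (forall i (x : R), derivable (g i) x 1) ->
  forall x, differentiable (coord_prod g) x.
Proof.
move=> dg x; rewrite /coord_prod.
elim: (index_enum _) => [|i s ih].
  by under eq_fun do rewrite big_nil; exact: differentiable_cst.
under eq_fun do rewrite big_cons.
apply: differentiableM => //.
apply: (@differentiable_comp _ _ _ _ (fun x : 'rV[R]_d => x ord0 i) (g i)).
  exact: differentiable_coord.
exact/derivable1_diffP.
Qed.

Lemma smooth_coord_prod g : (forall i, smooth1 (g i)) -> smooth (coord_prod g).
Proof.
move=> sg s x.
suff [g' sg' ->] : exists2 g', forall i, smooth1 (g' i) &
    foldr partial_derivative (coord_prod g) s = coord_prod g'.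
  apply: differentiable_coord_prod => i y.
  by have [_ /(_ y)[]] := smooth1_derive1 (sg' i).
elim: s => [|j s [g' sg' /= ->]]; first by exists g.
have [sgj dgj] := smooth1_derive1 (sg' j).
exists (fun i => if i == j then (g' j)^`()%classic else g' i) => [i|].
  by case: ifP.
exact: partial_derivative_coord_prod.
Qed.

End smooth_products.

(** * Boxes and Borel sets *)

Section boxes.
Context {R : realType} {d : nat}.
Local Notation mu :=
  (lebesgue_rV d : {sigma_finite_measure set 'rV[R]_d -> \bar R}).
Implicit Types (a b x : 'rV[R]_d).

Definition open_box a b : set 'rV[R]_d :=
  [set x | forall i, a ord0 i < x ord0 i < b ord0 i].

Definition closed_box a b : set 'rV[R]_d :=
  [set x | forall i, a ord0 i <= x ord0 i <= b ord0 i].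

Lemma open_box_closed_box a b : open_box a b `<=` closed_box a b.
Proof. by move=> x abx i; have /andP[/ltW -> /ltW ->] := abx i. Qed.

Lemma compact_closed_box a b : compact (closed_box a b).
Proof.
have := @rV_compact R d (fun i => `[a ord0 i, b ord0 i]%classic)
  (fun i => @segment_compact _ _ _).
by congr (compact _).
Qed.

Lemma compact_measurable_rV (K : set 'rV[R]_d) : compact K -> measurable K.
Proof.
move=> cK; rewrite -[K]setCK; apply: measurableC; apply: open_measurable_rV.
by rewrite openC; apply: compact_closed => //; exact: norm_hausdorff.
Qed.

Lemma measurable_open_box a b : measurable (open_box a b).
Proof.
have -> : open_box a b = \bigcap_(i in [set: 'I_d])
    ((fun x : 'rV[R]_d => x ord0 i) @^-1` `]a ord0 i, b ord0 i[%classic).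
  apply/seteqP; split => [x bx i _ /=|x bx i]; first by rewrite in_itv/= bx.
  by have := bx i I; rewrite /= in_itv.
apply: fin_bigcap_measurable; first exact: finite_finset.
by move=> i _; rewrite -[X in measurable X]setTI; exact: measurable_coord.
Qed.

Lemma norm_coord_le x i : `|x ord0 i| <= `|x|.
Proof.
rewrite [leRHS]/Num.norm /= mx_normrE.
by apply: (le_bigmax _ (fun ij => `|x ij.1 ij.2|) (ord0, i)).
Qed.

Lemma lebesgue_rV_compact_lty (K : set 'rV[R]_d) : compact K -> (mu K < +oo)%E.
Proof.
move=> cK; have [M [_ KM]] := compact_bounded cK.
pose c : 'rV[R]_d := const_mx (M + 1).
apply: (@le_lt_trans _ _ (mu (closed_box (- c) c))).
  apply: le_measure; rewrite ?inE; first exact: compact_measurable_rV.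
    by apply: compact_measurable_rV; exact: compact_closed_box.
  move=> x Kx i; rewrite !mxE -ler_norml (le_trans (norm_coord_le x i))//.
  by apply: KM Kx; rewrite ltrDl.
have -> : closed_box (- c) c =
    [set x | forall i, `[- (M + 1), M + 1]%classic (x ord0 i)].
  by apply/seteqP; split => x cx i; have := cx i; rewrite /= in_itv/= !mxE.
rewrite (lebesgue_rV_box (A := fun=> `[- (M + 1), M + 1]%classic))//.
set F := (\prod_(i < d) _)%E; suff /andP[] : (0 <= F < +oo)%E by [].
rewrite {}/F.
 apply: (big_ind (fun z => 0 <= z < +oo)%E) => [|u v|i _].
- by rewrite lee01 ltry.
- move=> /andP[u0 uoo] /andP[v0 voo]; rewrite mule_ge0//=.
  by rewrite lte_mul_pinfty// ge0_fin_numE.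
- rewrite measure_ge0/= lebesgue_measure_itv/=.
  by case: ifP => // _; rewrite -EFinB ltry.
Qed.

Lemma continuous_measurable_rV (f : 'rV[R]_d -> R) :
  continuous f -> measurable_fun [set: 'rV[R]_d] f.
Proof.
move=> /continuousP cf.
apply: (measurability _ (RGenOpens.measurableE R)) => _ [_ [a [b ->] <-]].
by rewrite setTI; apply: open_measurable_rV; apply: cf; exact: interval_open.
Qed.

Lemma open_boxI a b a' b' : exists2 ab : 'rV[R]_d * 'rV[R]_d,
  open_box a b `&` open_box a' b' = open_box ab.1 ab.2 &
  closed_box ab.1 ab.2 `<=` closed_box a b.
Proof.
exists (\row_i Num.max (a ord0 i) (a' ord0 i),
  \row_i Num.min (b ord0 i) (b' ord0 i)).
  apply/seteqP; split => [x [abx abx'] i|x abx].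
    have /andP[x1 x2] := abx i; have /andP[x3 x4] := abx' i.
    by rewrite !mxE gt_max lt_min x1 x2 x3 x4.
  split=> i; have := abx i; rewrite !mxE gt_max lt_min.
    by move=> /andP[/andP[x1 _] /andP[x3 _]]; apply/andP.
  by move=> /andP[/andP[_ x2] /andP[_ x4]]; apply/andP.
move=> x abx i; have := abx i; rewrite !mxE ge_max le_min.
by move=> /andP[/andP[-> _] /andP[-> _]].
Qed.

(** Bounded open boxes form a generating pi-system: the half-space
    {x | r < x_i} is the union of the boxes whose i-th side is ]r, k[ and whose
    other sides are ]-k, k[. *)
Lemma measurable_open_boxE : @measurable _ 'rV[R]_d =
  <<s [set open_box ab.1 ab.2 | ab in [set: 'rV[R]_d * 'rV[R]_d]] >>.
Proof.
apply/seteqP; split; last first.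
  apply: smallest_sub; first exact: sigma_algebra_measurable.
  by move=> _ [ab _ <-]; exact: measurable_open_box.
pose T := g_sigma_algebraType
  [set open_box ab.1 ab.2 | ab in [set: 'rV[R]_d * 'rV[R]_d]].
have midT : measurable_fun [set: T] (id : T -> 'rV[R]_d).
  apply: measurable_fun_rV => i.
  apply: (measurability _ (RGenOInfty.measurableE R)) => _ [_ [r ->] <-].
  rewrite setTI.
  rewrite [X in measurable X](_ : _ = \bigcup_k
    open_box (\row_j if j == i then r else - k%:R) (const_mx k%:R)).
    by apply: bigcup_measurable => k _; apply: sub_sigma_algebra; eexists (_, _).
  apply/seteqP; split => [x /=|x [k _] /(_ i)]; last first.
    by rewrite /= !mxE eqxx in_itv/= andbT => /andP[].
  rewrite in_itv/= andbT => rx.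
  exists (Num.truncn `|x|).+1 => // j; rewrite !mxE.
  have : `|x ord0 j| < (Num.truncn `|x|).+1%:R.
    by rewrite (le_lt_trans (norm_coord_le x j))// truncnS_gt.
  by rewrite ltr_norml => /andP[x1 ->]; rewrite andbT; case: eqP => // ->.
by move=> A mA; have := midT measurableT A mA; rewrite setTI.
Qed.

End boxes.

(** * Bump functions supported in a box *)

Section bumps.
Context {R : realType} {d : nat}.
Implicit Types (a b x : 'rV[R]_d).

(** The factor exp(-1/(m(s - a))) exp(-1/(m(b - s))) with m = n + 1 is positive
    exactly on ]a, b[.  Its support does not depend on n, and it tends to 1 inside
    the interval, so that the bumps approximate the indicator of the box without
    leaving it. *)
Definition bump a b (n : nat) : 'rV[R]_d -> R :=
  coord_prod (fun i s => flat 1 (n.+1%:R * s + - (n.+1%:R * a ord0 i)) *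
                         flat 1 (- n.+1%:R * s + n.+1%:R * b ord0 i)).

Lemma flat1_itv (s : R) : 0 <= flat 1 s <= 1.
Proof.
rewrite /flat; case: ifP => [s0|_]; last by rewrite lexx ler01.
by rewrite hornerC mul1r expR_ge0 expR_le1 oppr_le0 invr_ge0 ltW.
Qed.

Lemma flat1_eq0 (s : R) : s <= 0 -> flat 1 s = 0.
Proof. by move=> s0; rewrite /flat ltNge s0. Qed.

Lemma smooth_bump a b n : smooth (bump a b n).
Proof.
apply: smooth_coord_prod => i.
by apply: smooth1M; apply: smooth1_affine; exact: smooth1_flat.
Qed.

Lemma bump_itv a b n x : 0 <= bump a b n x <= 1.
Proof.
apply: (big_ind (fun z => 0 <= z <= 1)) => [|u v|i _].
- by rewrite ler01 lexx.
- by move=> /andP[u0 u1] /andP[v0 v1]; rewrite mulr_ge0//= mulr_ile1.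
- have /andP[u0 u1] := flat1_itv (n.+1%:R * x ord0 i + - (n.+1%:R * a ord0 i)).
  have /andP[v0 v1] := flat1_itv (- n.+1%:R * x ord0 i + n.+1%:R * b ord0 i).
  by rewrite mulr_ge0//= mulr_ile1.
Qed.

Lemma bump_neq0 a b n x : bump a b n x != 0 -> open_box a b x.
Proof.
move=> /prodf_neq0 bx i; have {bx} := bx i isT.
rewrite mulf_eq0 negb_or => /andP[/eqP xa /eqP xb].
rewrite -mulrBr in xa; rewrite mulNr addrC -mulrBr in xb.
apply/andP; split; rewrite ltNge; apply/negP => h.
  by apply: xa; apply: flat1_eq0; rewrite mulr_ge0_le0// subr_le0.
by apply: xb; apply: flat1_eq0; rewrite mulr_ge0_le0// subr_le0.
Qed.

Lemma cvg_flat1 (s : R) :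
  0 < s -> flat 1 (n.+1%:R * s) @[n --> \oo] --> (1 : R).
Proof.
move=> s0; rewrite /flat.
under eq_fun do rewrite pmulr_rgt0// s0 hornerC mul1r invfM -mulNr.
have : - (n.+1%:R^-1 : R) * s^-1 @[n --> \oo] --> - 0 * s^-1.
  by apply: cvgMl; apply: cvgN; exact: cvg_harmonic.
rewrite oppr0 mul0r => /cvg_comp /(_ (@continuous_expR R 0)).
by rewrite expR0; apply.
Qed.

Lemma cvg_bump a b x : bump a b n x @[n --> \oo] --> (\1_(open_box a b) x : R).
Proof.
rewrite indicE; case: (boolP (x \in _)) => [/set_mem abx|nabx]; last first.
  rewrite (_ : (fun n => _) = cst 0); first exact: cvg_cst.
  apply/funext => n; apply/eqP/negPn/negP => /bump_neq0 abx.
  by move/negP : nabx; apply; exact: mem_set.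
rewrite /bump /coord_prod.
rewrite [X in _ --> X](_ : _ = \prod_(i < d) (1 : R)); last by rewrite big1.
elim: (index_enum _) => [|i s ih].
  by under eq_fun do rewrite big_nil; rewrite big_nil; exact: cvg_cst.
under eq_fun do rewrite big_cons.
rewrite big_cons; apply: cvgM => //; have /andP[x1 x2] := abx i.
rewrite -[X in _ --> X]mulr1; apply: cvgM.
  under eq_fun do rewrite -mulrBr.
  by apply: cvg_flat1; rewrite subr_gt0.
under eq_fun do rewrite mulNr addrC -mulrBr.
by apply: cvg_flat1; rewrite subr_gt0.
Qed.

Lemma test_function_bump (D : domain R d) a b n :
  closed_box a b `<=` D -> test_function D (bump a b n).
Proof.
move=> abD.
have supp : closure [set x | bump a b n x != 0] `<=` closed_box a b.
  have /closure_id -> : closed (closed_box a b).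
    by apply: compact_closed; [exact: norm_hausdorff|exact: compact_closed_box].
  by apply: closure_subset => x /= /bump_neq0; exact: open_box_closed_box.
split; first exact: smooth_bump.
  apply: subclosed_compact supp; first exact: closed_closure.
  exact: compact_closed_box.
exact: subset_trans abD.
Qed.

End bumps.

(** * The fundamental lemma of the calculus of variations *)

Section fundamental_lemma.
Context {R : realType} {d : nat} (D : domain R d).
Local Notation mu :=
  (lebesgue_rV d : {sigma_finite_measure set 'rV[R]_d -> \bar R}).
Implicit Types (f phi : 'rV[R]_d -> R).

Lemma smooth_continuous phi : smooth phi -> continuous phi.
Proof.
by move=> sphi x; apply: differentiable_continuous; exact: (sphi [::] x).
Qed.

(** The second conclusion provides a dominating function that is common to all
    [g] with the same bound and support. *)
Lemma integrable_mul_bounded_support f (g : 'rV[R]_d -> R)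
    (K : set 'rV[R]_d) (M : R) :
  locally_integrable_on D f -> compact K -> K `<=` D ->
  measurable_fun D g -> (forall x, `|g x| <= M * \1_K x) ->
  mu.-integrable D (EFin \o (fun x => f x * g x)) /\
  mu.-integrable D (fun x => (M * `|f x| * \1_K x)%:E).
Proof.
move=> [mf lf] cK KD mg gM.
have mD := measurable_domain D; have mK := compact_measurable_rV cK.
have fK : mu.-integrable D (fun x => (M * `|f x| * \1_K x)%:E).
  have : mu.-integrable K (fun x => (M * `|f x|)%:E).
    apply: (eq_integrable mK
      (fun x => M%:E * (EFin \o (Num.norm \o f)) x)%E) => //.
    by apply: integrableZl => //; apply: integrable_norm; exact: lf.
  rewrite -[X in mu.-integrable X](setIidr KD).
  move=> /(integrable_restrict mu mK mD); apply: eq_integrable => // x _.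
  by rewrite /= /patch indicE; case: ifPn => _; rewrite ?mulr1 ?mulr0.
split => //.
apply: (le_integrable mD _ _ fK).
  by apply/measurable_EFinP; apply: measurable_funM.
move=> x Dx; rewrite /= lee_fin normrM [leRHS]ger0_norm.
  by rewrite mulrAC mulrC ler_wpM2r.
by rewrite mulrAC mulr_ge0// (le_trans _ (gM x)).
Qed.

(** The integrals against the bumps vanish and converge, by dominated convergence,
    to the integral over the box. *)
Lemma integral_open_box_eq0 f :
  locally_integrable_on D f ->
  (forall phi, test_function D phi -> \int[mu]_(x in D) (f x * phi x) = 0) ->
  forall a b, closed_box a b `<=` D ->
  (\int[mu]_(x in open_box a b) (f x)%:E = 0)%E.
Proof.
move=> lf f0 a b abD; have mD := measurable_domain D.
have cab := @compact_closed_box R d a b.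
have mab := measurable_open_box a b.
have mb n : measurable_fun D (bump a b n).
  apply: measurable_funTS; apply: continuous_measurable_rV.
  by apply: smooth_continuous; exact: smooth_bump.
have bK n x : `|bump a b n x| <= 1 * \1_(closed_box a b) x.
  have /andP[b0 b1] := bump_itv a b n x.
  rewrite mul1r ger0_norm//; have [->|] := eqVneq (bump a b n x) 0.
    by rewrite indicE.
  by move=> /bump_neq0 /open_box_closed_box ?; rewrite indicE mem_set.
have ib n := integrable_mul_bounded_support lf cab abD (mb n) (bK n).
have mlim : measurable_fun D (fun x => (f x * \1_(open_box a b) x)%:E).
  apply/measurable_EFinP; apply: measurable_funM; first exact: lf.1.
  exact: measurable_indic.
have cvgf x : (f x * bump a b n x)%:E @[n --> \oo] -->
    (f x * \1_(open_box a b) x)%:E.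
  by apply: cvg_EFin; [exact: nearW|apply: cvgMr; exact: cvg_bump].
have domf x n : (`|(f x * bump a b n x)%:E| <=
    (1 * `|f x| * \1_(closed_box a b) x)%:E)%E.
  rewrite /= lee_fin normrM mul1r ler_wpM2l//.
  by have := bK n x; rewrite mul1r.
have [_ _] := dominated_convergence mD (fun n => measurable_int _ (ib n).1) mlim
  (aeW _ (fun x _ => cvgf x)) (ib 0%N).2 (aeW _ (fun x n _ => domf x n)).
rewrite [X in X @ _ --> _](_ : _ = cst 0%E); last first.
  apply/funext => n /=.
  have := f0 _ (test_function_bump n abD).
  rewrite /Rintegral => fib0; rewrite -[LHS]fineK ?fib0//.
  by apply: integrable_fin_num => //; exact: (ib n).1.
move=> h; have {}h := cvg_unique (@ereal_hausdorff R) (cvg_cst _) h.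
rewrite [RHS]h.
rewrite -[in LHS](setIidr (subset_trans (@open_box_closed_box _ _ a b) abD)).
rewrite integral_mkcondr; apply: eq_integral => x _.
by rewrite /patch indicE; case: ifPn => _; rewrite ?mulr1 ?mulr0.
Qed.

(** The Borel sets E such that f has zero integral over the trace of E on a fixed
    box form a Dynkin system that contains all boxes, hence all Borel sets; so f
    vanishes almost everywhere on that box. *)
Lemma ae_eq0_open_box f :
  locally_integrable_on D f ->
  (forall phi, test_function D phi -> \int[mu]_(x in D) (f x * phi x) = 0) ->
  forall a b, closed_box a b `<=` D ->
  ae_eq mu (open_box a b) (EFin \o f) (cst 0%E).
Proof.
move=> lf f0 a b abD; set B := open_box a b.
have mB : measurable B by exact: measurable_open_box.
have iB : mu.-integrable B (EFin \o f).
  have cab := @compact_closed_box R d a b.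
  apply: (integrableS (compact_measurable_rV cab)) => //.
    exact: open_box_closed_box.
  exact: lf.2.
have iS S : measurable S -> mu.-integrable (S `&` B) (EFin \o f).
  by move=> mS; apply: integrableS iB => //; exact: measurableI.
apply: integral_ae_eq => // E EB mE.
rewrite integral_cst// mul0e -(setIidl EB).
move: mE; rewrite measurable_open_boxE.
apply: (dynkin_induction
  (P := fun E => (\int[mu]_(x in E `&` B) (f x)%:E = 0)%E)
  (@measurable_open_boxE R d)).
- move=> _ _ [ab _ <-] [ab' _ <-].
  by have [c -> _] := open_boxI ab.1 ab.2 ab'.1 ab'.2; exists c.
- by rewrite setTI; exact: integral_open_box_eq0.
- move=> _ [c _ <-] /=; have [ab] := open_boxI a b c.1 c.2.
  rewrite setIC => -> abs; apply: integral_open_box_eq0 => //.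
  exact: subset_trans abD.
- move=> S mS S0.
  have : (\int[mu]_(x in B) (f x)%:E = 0)%E by exact: integral_open_box_eq0.
  rewrite -{1}(setIT B) -(setUv S) setIUr integral_setU//.
  + by rewrite ![B `&` _]setIC S0 add0e.
  + exact: measurableI.
  + by apply: measurableI => //; exact: measurableC.
  + apply: measurable_funS (measurable_int _ iB) => //.
    by move=> x [[]|[]].
  + by apply/disj_setPS => x [[_ Sx] [_]]; exact.
- move=> F mF tF F0; rewrite setI_bigcupl integral_bigcup//.
  + by rewrite eseries0.
  + exact: trivIset_setIr.
  + by move=> k; exact: measurableI.
  + by rewrite -setI_bigcupl; apply: iS; exact: bigcup_measurable.
Qed.

(** D is the union of the countably many open boxes with rational vertices whose
    closure lies in D, and f vanishes almost everywhere on each of them. *)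
Lemma ae_eq0_test_function f :
  locally_integrable_on D f ->
  (forall phi, test_function D phi -> \int[mu]_(x in D) (f x * phi x) = 0) ->
  {ae mu, forall x, domain_set D x -> f x = 0}.
Proof.
move=> lf f0.
pose rbox (q : 'rV[rat]_d * 'rV[rat]_d) :=
  (map_mx (ratr : rat -> R) q.1, map_mx (ratr : rat -> R) q.2).
pose N (k : nat) : set 'rV[R]_d := if unpickle k is Some q then
  [set x | [/\ closed_box (rbox q).1 (rbox q).2 `<=` D,
    open_box (rbox q).1 (rbox q).2 x & f x <> 0]] else set0.
apply: (@negligibleS _ _ _ mu (\bigcup_k N k)); last first.
  apply: negligible_bigcup => k; rewrite /N.
  case: unpickle => [q|]; last exact: negligible_set0.
  have [qD|nqD] := pselect (closed_box (rbox q).1 (rbox q).2 `<=` D);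
    last first.
    by apply: negligibleS (negligible_set0 mu) => x [].
  apply: negligibleS (ae_eq0_open_box lf f0 qD) => x [_ qx fx] /= /(_ qx) [].
  exact.
move=> x /= /not_implyP [Dx fx].
have /nbhs_ballP[e /= e0 xeD] : nbhs x D.
  by apply: open_nbhs_nbhs; split => //; exact: domain_open.
have ratP (y z : R) : y < z -> exists q : rat, y < ratr q < z.
  by move=> /rat_in_itvoo[q]; rewrite in_itv; exists q.
have /choice[a aP] : forall i, exists q : rat, x ord0 i - e < ratr q < x ord0 i.
  by move=> i; apply: ratP; rewrite ltrBlDr ltrDl.
have /choice[b bP] : forall i, exists q : rat, x ord0 i < ratr q < x ord0 i + e.
  by move=> i; apply: ratP; rewrite ltrDl.
exists (pickle (\row_i a i, \row_i b i)) => //; rewrite /N pickleK; split => //.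
  move=> y yab; apply: xeD; split => // i j; rewrite ord1.
  have := yab j; rewrite !mxE => /andP[y1 y2].
  have /andP[a1 _] := aP j; have /andP[_ b2] := bP j.
  rewrite /ball/= ltr_distlC; apply/andP; split; first exact: lt_le_trans a1 y1.
  exact: le_lt_trans y2 b2.
move=> i /=; rewrite !mxE.
by have /andP[_ ->] := aP i; have /andP[-> _] := bP i.
Qed.

End fundamental_lemma.

(** * Sequences with geometrically decreasing steps *)

Lemma geometric_steps_cvg {R : realType} (u : R^nat) (A s : R) :
  0 <= A -> 0 < s -> s < 1 ->
  (forall k, `|u k.+1 - u k| <= A * s ^+ k) ->
  cvgn u /\ forall n, `|u n - limn u| <= A / (1 - s) * s ^+ n.
Proof.
move=> A0 s0 s1 us.
have s1' : `|s| < 1 by rewrite gtr0_norm.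
have cu : cvgn u.
  have -> : u = cst (u 0%N) + series (telescope u).
    by apply/funext => n; exact: eq_sum_telescope.
  apply: is_cvgD; first exact: is_cvg_cst.
  apply: normed_cvg; apply: (@series_le_cvg _ _ (geometric A s)) => //.
  - by move=> n /=; exact: normr_ge0.
  - by move=> n; rewrite /geometric/= mulr_ge0// exprn_ge0// ltW.
  - exact: is_cvg_geometric_series.
split=> // n.
have um m : `|u n - u (n + m)%N| <= A / (1 - s) * s ^+ n * (1 - s ^+ m).
  elim: m => [|m ih]; first by rewrite addn0 subrr normr0 subrr mulr0.
  rewrite addnS -(subrK (u (n + m)%N) (u n)) -addrA (le_trans (ler_normD _ _))//.
  rewrite [X in _ + X <= _]distrC (le_trans (lerD ih (us _)))//.
  rewrite le_eqVlt; apply/orP; left; apply/eqP; rewrite exprD exprS; field.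
  by rewrite subr_eq0 gt_eqF.
have : cvgn (fun m => `|u n - u m|).
  by apply: is_cvg_norm; apply: is_cvgB => //; exact: is_cvg_cst.
move=> cnu; have <- : limn (fun m => `|u n - u m|) = `|u n - limn u|.
  by rewrite lim_norm; [rewrite limB//; [rewrite lim_cst|exact: is_cvg_cst]|
    apply: is_cvgB => //; exact: is_cvg_cst].
apply: limr_le => //; near=> m.
have nm : (n <= m)%N by near: m; exact: nbhs_infty_ge.
rewrite -(subnKC nm) (le_trans (um _))//.
rewrite ler_piMr ?gerBl ?mulr_ge0 ?invr_ge0 ?exprn_ge0 ?subr_ge0//.
- exact: ltW.
- exact: ltW.
- exact: ltW.
Unshelve. all: by end_near. Qed.

(** A form of the Riesz-Fischer theorem.  The weights s^(-2n) make
    S = sum_n s^(-2n) (f_(n+1) - f_n)^2 integrable, hence finite almost everywhere;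
    at such a point the n-th step is at most sqrt(S) s^n, so that f_n converges
    pointwise with error at most s^n sqrt(S) / (1 - s).  The single
    square-integrable function [h] thus controls both the pointwise and the L^2
    convergence, and dominates the whole sequence. *)
Lemma geometric_steps_L2 {dsp} {T : measurableType dsp} {R : realType}
    (mu : {measure set T -> \bar R}) (D : set T) (f : nat -> T -> R) (C s : R) :
  measurable D -> 0 < s -> s < 1 -> (forall n, measurable_fun D (f n)) ->
  (forall n, (\int[mu]_(x in D) ((f n.+1 x - f n x) ^+ 2)%:E <=
    (C * (s ^+ 4) ^+ n)%:E)%E) ->
  exists g h : T -> R, [/\ measurable_fun D g, measurable_fun D h,
    mu.-integrable D (EFin \o (fun x => h x ^+ 2)) &
    {ae mu, forall x, D x -> forall n, `|f n x - g x| <= s ^+ n * h x}].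
Proof.
move=> mD s0 s1 mf fC.
pose a n x := (s ^- 2) ^+ n * (f n.+1 x - f n x) ^+ 2.
have a0 n x : (0 <= (a n x)%:E)%E.
  by rewrite lee_fin mulr_ge0 ?sqr_ge0// exprn_ge0// invr_ge0 sqr_ge0.
have ma n : measurable_fun D (EFin \o a n).
  apply/measurable_EFinP; apply: measurable_funM => //.
  by apply: measurable_funX; apply: measurable_funB.
pose S x := (\sum_(0 <= n <oo) (a n x)%:E)%E.
have S0 x : (0 <= S x)%E by exact: nneseries_ge0.
have mS : measurable_fun D S.
  have := @ge0_emeasurable_sum _ _ _ D (fun n x => (a n x)%:E) xpredT.
  by apply => [k x _ _|k _]; [exact: a0|exact: ma].
have iS : mu.-integrable D S.
  apply/integrableP; split => //.
  under eq_integral do rewrite gee0_abs//.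
  rewrite integral_nneseries//.
  apply: (@le_lt_trans _ _ (\sum_(0 <= n <oo) (geometric C (s ^+ 2) n)%:E)%E).
    apply: lee_nneseries => [n _ _|n _]; first exact: integral_ge0.
    under eq_integral do rewrite EFinM.
    have sn0 : 0 <= s ^- 2 ^+ n by rewrite exprn_ge0// invr_ge0 sqr_ge0.
    rewrite ge0_integralZl_EFin//.
      apply: (le_trans (lee_wpmul2l _ (fC n))); rewrite ?lee_fin//.
      rewrite le_eqVlt; apply/orP; left; apply/eqP.
      rewrite /geometric/= mulrCA -exprMn; congr (_ * _ ^+ _).
      by field; rewrite gt_eqF.
    - by move=> x _; rewrite lee_fin sqr_ge0.
    - by apply/measurable_EFinP; apply: measurable_funX; exact: measurable_funB.
  have s21 : `|s ^+ 2| < 1 by rewrite ger0_norm ?sqr_ge0// expr_lt1// ltW.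
  rewrite (_ : (\sum_(0 <= n <oo) _)%E =
      limn (EFin \o series (geometric C (s ^+ 2)))).
    rewrite EFin_lim ?ltry//; exact: is_cvg_geometric_series.
  by congr (limn _); apply/funext => n /=; rewrite sumEFin.
have fS : {ae mu, forall x, D x -> S x \is a fin_num} by exact: integrable_ae.
(* The upper limit is measurable without restricting to the convergence set. *)
pose g x := fine (limn_esup (fun n => (f n x)%:E)).
exists g, (fun x => Num.sqrt (fine (S x)) / (1 - s)); split.
- apply: (measurableT_comp (fine_measurable measurableT)).
  by apply: measurable_fun_limn_esup => n; exact/measurable_EFinP.
- apply: measurable_funM => //.
  apply: (measurableT_comp (continuous_measurable_fun (@sqrt_continuous R))).
  exact: (measurableT_comp (fine_measurable measurableT)).
- rewrite (_ : EFin \o _ =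
      fun x => ((1 - s) ^- 2)%:E * (fine (S x))%:E)%E; last first.
    apply/funext => x.
    by rewrite /= exprMn sqr_sqrtr ?fine_ge0// exprVn mulrC EFinM.
  apply: integrableZl => //; apply: le_integrable iS => //.
    apply/measurable_EFinP.
    exact: (measurableT_comp (fine_measurable measurableT)).
  move=> x _; rewrite gee0_abs ?lee_fin ?fine_ge0// gee0_abs//.
  by case: (S x) (S0 x) => //= _; exact: leey.
- apply: filterS fS => x /[apply] Sx n.
  have step k : `|f k.+1 x - f k x| <= Num.sqrt (fine (S x)) * s ^+ k.
    have Sk : (f k.+1 x - f k x) ^+ 2 <= fine (S x) * s ^+ k ^+ 2.
      have : ((a k x)%:E <= S x)%E.
        apply: le_trans (nneseries_lim_ge k.+1 _) => //.
        by rewrite big_nat_recr//= leeDr// sume_ge0.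
      rewrite -{1}[S x]fineK// lee_fin /a -exprVn -exprM mulnC exprM.
      by rewrite 2!exprVn mulrC ler_pdivrMr// !exprn_gt0.
    rewrite -ler_sqr ?nnegrE ?mulr_ge0 ?sqrtr_ge0 ?exprn_ge0 ?(ltW s0)//.
    by rewrite -normrX ger0_norm ?sqr_ge0// exprMn sqr_sqrtr// fine_ge0.
  have [cf fl] := geometric_steps_cvg (sqrtr_ge0 _) s0 s1 step.
  have -> : g x = limn (fun n => f n x).
    have fE : (f n x)%:E @[n --> \oo] --> (limn (fun n => f n x))%:E.
      by apply: cvg_EFin => //; exact: nearW.
    by rewrite /g is_cvg_limn_esupE ?(cvg_lim _ fE)//;
      apply/cvg_ex; eexists; exact: fE.
  by rewrite mulrC.
Qed.

(** * Test functions and weak derivatives *)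

Lemma sqrB_le {R : realDomainType} (a b : R) :
  (a - b) ^+ 2 <= 2 * (a ^+ 2 + b ^+ 2).
Proof. by have := sqr_ge0 (a + b); nra. Qed.

Section test_functions.
Context {R : realType} {d : nat} (D : domain R d).
Local Notation mu :=
  (lebesgue_rV d : {sigma_finite_measure set 'rV[R]_d -> \bar R}).
Implicit Types (f phi u v : 'rV[R]_d -> R) (alpha : 'I_d -> nat).

Lemma closure_support_partial_derivative i phi :
  closure [set x | partial_derivative i phi x != 0] `<=`
  closure [set x | phi x != 0].
Proof.
rewrite [X in _ `<=` X](closure_id _).1; last exact: closed_closure.
apply: closure_subset => x /=.
apply: contra_neqP => nx.
have phi0 : \forall y \near x, phi y = cst 0 y.
  have : nbhs x (~` closure [set x | phi x != 0]).
    by apply: open_nbhs_nbhs; split => //; rewrite openC; exact: closed_closure.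
  apply: filterS => y ny /=; apply: contra_notP ny => /eqP ny.
  exact: subset_closure.
by rewrite /partial_derivative (near_eq_derive _ phi0) derive_cst.
Qed.

Lemma test_function_partial_derivative i phi :
  test_function D phi -> test_function D (partial_derivative i phi).
Proof.
move=> [sphi cphi phiD]; have sub := @closure_support_partial_derivative i phi.
split=> [s x||].
- by have := sphi (rcons s i) x; rewrite foldr_rcons.
- by apply: subclosed_compact sub => //; exact: closed_closure.
- exact: subset_trans sub phiD.
Qed.

Lemma test_function_multi_derivative alpha phi :
  test_function D phi -> test_function D (multi_derivative alpha phi).
Proof.
move=> tphi; rewrite /multi_derivative.
elim: (enum _) => [//|i s ih] /=.
by elim: (alpha i) => [//|n] /=; exact: test_function_partial_derivative.
Qed.

Lemma test_function_bounded phi : test_function D phi ->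
  exists K (M : R), [/\ compact K, K `<=` D & forall x, `|phi x| <= M * \1_K x].
Proof.
move=> [sphi cphi phiD]; set K := closure _ in cphi phiD.
have : compact (phi @` K).
  apply: continuous_compact => //; apply: continuous_subspaceT.
  exact: smooth_continuous.
move=> /compact_bounded[M [_ KM]]; exists K, (M + 1); split => // x.
rewrite indicE; case: (boolP (x \in K)) => [/set_mem Kx|nKx].
  rewrite mulr1; apply: (KM (M + 1)); first by rewrite ltrDl.
  by exists x.
rewrite mulr0 normr_le0; apply: contraNT nKx => nx.
by rewrite inE; exact: subset_closure.
Qed.

Lemma test_function_measurable phi (A : set 'rV[R]_d) :
  test_function D phi -> measurable_fun A phi.
Proof.
move=> [sphi _ _]; apply: measurable_funTS.
by apply: continuous_measurable_rV; exact: smooth_continuous.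
Qed.

Lemma integrable_mul_test_function f phi :
  locally_integrable_on D f -> test_function D phi ->
  mu.-integrable D (EFin \o (fun x => f x * phi x)).
Proof.
move=> lf tphi; have [K [M [cK KD phiM]]] := test_function_bounded tphi.
have [] // := integrable_mul_bounded_support lf cK KD _ phiM.
exact: test_function_measurable.
Qed.

End test_functions.

Section weak_derivative_theory.
Context {R : realType} {d : nat} (D : domain R d).
Local Notation mu :=
  (lebesgue_rV d : {sigma_finite_measure set 'rV[R]_d -> \bar R}).
Implicit Types (f phi u v : 'rV[R]_d -> R) (alpha : 'I_d -> nat).

Let mD : measurable (D : set 'rV[R]_d) := measurable_domain D.

Lemma locally_integrable_onB f g :
  locally_integrable_on D f -> locally_integrable_on D g ->
  locally_integrable_on D (f \- g).
Proof.
move=> [mf lf] [mg lg]; split; first exact: measurable_funB.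
move=> K cK KD.
have mK := compact_measurable_rV cK.
by have := integrableB mK (lf K cK KD) (lg K cK KD).
Qed.

Lemma ae_locally_integrable_on f g : locally_integrable_on D f ->
  measurable_fun D g -> {ae mu, forall x, domain_set D x -> f x = g x} ->
  locally_integrable_on D g.
Proof.
move=> [mf lf] mg fg; split => // K cK KD; have mK := compact_measurable_rV cK.
have mgK : measurable_fun K (EFin \o g).
  by apply/measurable_EFinP; exact: measurable_funS mg.
apply/integrableP; split => //.
have /integrableP[mfK] := lf K cK KD; congr (_ < _)%E.
apply: ge0_ae_eq_integral => //; try exact: measurableT_comp.
by apply: filterS fg => x fgx /KD /fgx /= ->.
Qed.

Lemma ae_eq_Rintegral f g (A : set 'rV[R]_d) :
  measurable A -> measurable_fun A f -> measurable_fun A g ->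
  {ae mu, forall x, A x -> f x = g x} ->
  \int[mu]_(x in A) f x = \int[mu]_(x in A) g x.
Proof.
move=> mA mf mg fg; congr fine; apply: ae_eq_integral => //.
- exact/measurable_EFinP.
- exact/measurable_EFinP.
- by apply: filterS fg => x fgx /fgx ->.
Qed.

(** The difference of two weak derivatives integrates to 0 against every test
    function. *)
Lemma weak_derivative_unique alpha u v v' :
  weak_derivative D alpha u v -> weak_derivative D alpha u v' ->
  {ae mu, forall x, domain_set D x -> v x = v' x}.
Proof.
move=> [_ lv uv] [_ lv' uv'].
have : {ae mu, forall x, domain_set D x -> (v \- v') x = 0}.
  apply: ae_eq0_test_function; first exact: locally_integrable_onB.
  move=> phi tphi; under eq_Rintegral do rewrite mulrBl.
  rewrite RintegralB//; [|exact: integrable_mul_test_function..].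
  apply/eqP; rewrite subr_eq0; apply/eqP.
  apply: (@mulfI _ ((-1) ^+ multi_order alpha)); first by rewrite signr_eq0.
  by rewrite -uv// -uv'.
by apply: filterS => x vx /vx /eqP; rewrite subr_eq0 => /eqP.
Qed.

Lemma weak_derivativeB alpha u u' v v' :
  weak_derivative D alpha u v -> weak_derivative D alpha u' v' ->
  weak_derivative D alpha (u \- u') (v \- v').
Proof.
move=> [lu lv uv] [lu' lv' uv']; split; try exact: locally_integrable_onB.
move=> phi tphi; have tdphi := test_function_multi_derivative alpha tphi.
under eq_Rintegral do rewrite mulrBl.
rewrite RintegralB//; [|exact: integrable_mul_test_function..].
under [in RHS]eq_Rintegral do rewrite mulrBl.
rewrite RintegralB//; [|exact: integrable_mul_test_function..].
by rewrite mulrBr uv// uv'.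
Qed.

Lemma weak_derivative_ae alpha u u' v : measurable_fun D u' ->
  {ae mu, forall x, domain_set D x -> u x = u' x} ->
  weak_derivative D alpha u v -> weak_derivative D alpha u' v.
Proof.
move=> mu' uu' [lu lv uv]; have lu' := ae_locally_integrable_on lu mu' uu'.
split => // phi tphi; rewrite -uv//.
have mphi : measurable_fun D (multi_derivative alpha phi).
  exact: test_function_measurable (test_function_multi_derivative alpha tphi).
apply: ae_eq_Rintegral => //.
- exact: measurable_funM.
- by apply: measurable_funM => //; exact: lu.1.
- by apply: filterS uu' => x + Dx => /(_ Dx) ->.
Qed.

Lemma weak_derivative_order0 alpha u : (forall i, alpha i = 0%N) ->
  locally_integrable_on D u -> weak_derivative D alpha u u.
Proof.
move=> alpha0 lu; split => // phi _.
rewrite /multi_order big1// expr0 mul1r /multi_derivative; congr Rintegral.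
apply/funext => x; congr (_ * _ x).
by elim: (enum _) => [//|i s /= ->]; rewrite alpha0.
Qed.

Lemma weakDP alpha u v : weak_derivative D alpha u v ->
  weak_derivative D alpha u (weakD D alpha u) /\
  {ae mu, forall x, domain_set D x -> weakD D alpha u x = v x}.
Proof.
move=> uv; have wu : weak_derivative D alpha u (weakD D alpha u).
  by apply: (@getPex _ [set w | weak_derivative D alpha u w]); exists v.
by split => //; exact: weak_derivative_unique uv.
Qed.

(** On a compact set |f| <= 1 + f^2, and compact sets have finite measure. *)
Lemma square_integrable_locally_integrable_on f :
  measurable_fun D f -> square_integrable_on D f -> locally_integrable_on D f.
Proof.
move=> mf f2; split => // K cK KD; have mK := compact_measurable_rV cK.
have iK : mu.-integrable K (fun x => (1 + f x ^+ 2)%:E).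
  have i1 : mu.-integrable K (cst 1%E).
    apply/integrableP; split => //.
    rewrite (eq_integral (cst 1%E)); last by move=> x _; rewrite /= normr1.
    by rewrite integral_cst// mul1e; exact: lebesgue_rV_compact_lty.
  by have := integrableD mK i1 (integrableS mD mK KD f2).
apply: le_integrable iK => //.
  by apply/measurable_EFinP; exact: measurable_funS mf.
move=> x _; rewrite /= lee_fin [leRHS]ger0_norm ?addr_ge0 ?sqr_ge0//.
rewrite ler_norml; apply/andP; split; nra.
Qed.

Lemma ae_square_integrable_on f g : square_integrable_on D f ->
  measurable_fun D g -> {ae mu, forall x, domain_set D x -> f x = g x} ->
  square_integrable_on D g.
Proof.
move=> f2 mg fg; apply/integrableP; split.
  by apply/measurable_EFinP; exact: measurable_funX.
have /integrableP[mf2] := f2; congr (_ < _)%E; apply: ge0_ae_eq_integral => //.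
- exact: measurableT_comp.
- apply: measurableT_comp => //.
  by apply/measurable_EFinP; exact: measurable_funX.
- by apply: filterS fg => x fgx Dx /=; rewrite fgx.
Qed.

Lemma square_integrable_onB f g : measurable_fun D f -> measurable_fun D g ->
  square_integrable_on D f -> square_integrable_on D g ->
  square_integrable_on D (f \- g).
Proof.
move=> mf mg f2 g2.
have fg : mu.-integrable D (fun x => (2 * (f x ^+ 2 + g x ^+ 2))%:E).
  have := integrableZl mD 2 (integrableD mD f2 g2); apply: eq_integrable => //.
apply: le_integrable fg => //.
  by apply/measurable_EFinP; apply: measurable_funX; exact: measurable_funB.
move=> x _; rewrite /= lee_fin ger0_norm ?sqr_ge0//.
by rewrite (le_trans (sqrB_le _ _))// ler_norm.
Qed.

End weak_derivative_theory.

(** * Limits of weak derivatives *)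

Section limits.
Context {R : realType} {d : nat} (D : domain R d).
Local Notation mu :=
  (lebesgue_rV d : {sigma_finite_measure set 'rV[R]_d -> \bar R}).
Implicit Types (f g phi h : 'rV[R]_d -> R) (alpha : 'I_d -> nat).

Let mD : measurable (D : set 'rV[R]_d) := measurable_domain D.

Lemma locally_integrable_onD f g :
  locally_integrable_on D f -> locally_integrable_on D g ->
  locally_integrable_on D (f \+ g).
Proof.
move=> [mf lf] [mg lg]; split; first exact: measurable_funD.
move=> K cK KD; have mK := compact_measurable_rV cK.
by have := integrableD mK (lf K cK KD) (lg K cK KD).
Qed.

Lemma locally_integrable_on_norm f :
  locally_integrable_on D f -> locally_integrable_on D (fun x => `|f x|).
Proof.
move=> [mf lf]; split; first exact: measurableT_comp.
by move=> K cK KD; apply: integrable_norm; exact: lf.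
Qed.

(** Dominated convergence: the sequence is dominated by |f| + |h|, which becomes
    integrable once multiplied by a test function. *)
Lemma geometric_cvg_Rintegral_test_function (f_ : nat -> 'rV[R]_d -> R) f h
    (s : R) phi :
  0 < s -> s < 1 ->
  (forall n, locally_integrable_on D (f_ n)) ->
  locally_integrable_on D f -> locally_integrable_on D h ->
  {ae mu, forall x, domain_set D x ->
    forall n, `|f_ n x - f x| <= s ^+ n * h x} ->
  test_function D phi ->
  \int[mu]_(x in D) (f_ n x * phi x) @[n --> \oo] -->
  \int[mu]_(x in D) (f x * phi x).
Proof.
move=> s0 s1 lf_ lf lh f_h tphi.
have lg := locally_integrable_onD (locally_integrable_on_norm lf)
  (locally_integrable_on_norm lh).
have ig := integrable_abse (integrable_mul_test_function lg tphi).
have if_ n := integrable_mul_test_function (lf_ n) tphi.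
have iF := integrable_mul_test_function lf tphi.
have cvgf : {ae mu, forall x, domain_set D x ->
    (f_ n x * phi x)%:E @[n --> \oo] --> (f x * phi x)%:E}.
  apply: filterS f_h => x /[apply] fh.
  apply: cvg_EFin; first exact: nearW.
  apply: cvgMl; apply/subr_cvg0/norm_cvg0P.
  apply: (@squeeze_cvgr _ _ _ _ (cst 0) (geometric (h x) s)).
  - by apply: nearW => n; rewrite normr_ge0/= mulrC.
  - exact: cvg_cst.
  - by apply: cvg_geometric; rewrite gtr0_norm.
have domf : {ae mu, forall x n, domain_set D x -> (`|(f_ n x * phi x)%:E| <=
    (abse \o (EFin \o (fun x => (`|f x| + `|h x|) * phi x)%R)) x)%E}.
  apply: filterS f_h => x + n Dx => /(_ Dx n) fh.
  rewrite /= lee_fin !normrM ler_wpM2r// [leRHS]ger0_norm ?addr_ge0//.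
  rewrite -[f_ n x](subrK (f x)) addrC (le_trans (ler_normD _ _))// lerD2l.
  rewrite (le_trans fh)// (le_trans (ler_norm _))// normrM ler_piMl//.
  by rewrite normrX exprn_ile1// gtr0_norm// ltW.
have [_ _ cvgi] := dominated_convergence mD (fun n => measurable_int _ (if_ n))
  (measurable_int _ iF) cvgf ig domf.
apply: fine_cvg; rewrite fineK; last exact: integrable_fin_num.
exact: cvgi.
Qed.

Lemma weak_derivative_cvg alpha (u_ v_ : nat -> 'rV[R]_d -> R) u v g h (s : R) :
  0 < s -> s < 1 ->
  (forall n, weak_derivative D alpha (u_ n) (v_ n)) ->
  locally_integrable_on D u -> locally_integrable_on D v ->
  locally_integrable_on D g -> locally_integrable_on D h ->
  {ae mu, forall x, domain_set D x ->
    forall n, `|u_ n x - u x| <= s ^+ n * g x} ->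
  {ae mu, forall x, domain_set D x ->
    forall n, `|v_ n x - v x| <= s ^+ n * h x} ->
  weak_derivative D alpha u v.
Proof.
move=> s0 s1 uv lu lv lg lh u_g v_h; split => // phi tphi.
have tdphi := test_function_multi_derivative alpha tphi.
have lu_ n : locally_integrable_on D (u_ n) by have [] := uv n.
have lv_ n : locally_integrable_on D (v_ n) by have [] := uv n.
have cu := geometric_cvg_Rintegral_test_function s0 s1 lu_ lu lg u_g tdphi.
have cv := geometric_cvg_Rintegral_test_function s0 s1 lv_ lv lh v_h tphi.
apply: (cvg_unique (@Rhausdorff R) cu).
rewrite /= [X in X @ _ --> _](_ : _ = fun n =>
    (-1) ^+ multi_order alpha * \int[mu]_(x in D) (v_ n x * phi x)).
  exact: cvgMr.
by apply/funext => n; have [_ _] := uv n; apply.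
Qed.

End limits.

(** * The Sobolev norm *)

(** Replaces three quantities at once by given equations; below these are squared
    Sobolev norms of different functions. *)
Lemma le_double_add {R : numDomainType} (a b c a' b' c' : R) :
  a = a' -> b = b' -> c = c' -> a' <= 2 * (b' + c') -> a <= 2 * (b + c).
Proof. by move=> -> -> ->. Qed.

Section sobolev_norm_theory.
Context {R : realType} {d : nat} (t : nat) (D : domain R d).
Local Notation mu :=
  (lebesgue_rV d : {sigma_finite_measure set 'rV[R]_d -> \bar R}).
Local Notation N := (sobolev_norm t D).
Implicit Types (f g v w : 'rV[R]_d -> R) (alpha : 'I_d -> nat).

Let mD : measurable (D : set 'rV[R]_d) := measurable_domain D.

(** Functions, as opposed to classes of functions modulo almost everywhere
    equality, with square-integrable weak derivatives up to order t. *)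
Definition sobolev_function f := forall alpha, (multi_order alpha <= t)%N ->
  exists2 v, weak_derivative D alpha f v & square_integrable_on D v.

Definition multi_index (beta : {ffun 'I_d -> 'I_t.+1}) : 'I_d -> nat :=
  fun i => beta i.

Lemma multi_indexP alpha : (multi_order alpha <= t)%N ->
  exists beta, multi_index beta = alpha.
Proof.
move=> alphat; exists [ffun i => inord (alpha i)]; apply/funext => i.
rewrite /multi_index ffunE inordK// ltnS (leq_trans _ alphat)//.
by rewrite /multi_order (bigD1 i)//= leq_addr.
Qed.

Lemma sobolev_functionB f g :
  sobolev_function f -> sobolev_function g -> sobolev_function (f \- g).
Proof.
move=> Hf Hg alpha alphat.
have [v fv v2] := Hf _ alphat; have [w gw w2] := Hg _ alphat.
exists (v \- w); first exact: weak_derivativeB.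
have [_ [mv _] _] := fv; have [_ [mw _] _] := gw.
exact: square_integrable_onB.
Qed.

Lemma sobolev_function_sobolev (u : sobolev t D) : sobolev_function u.
Proof. exact: sobolev_weak_derivatives. Qed.

Lemma multi_order0 : (multi_order (fun _ : 'I_d => 0%N) <= t)%N.
Proof. by rewrite /multi_order big1. Qed.

(** The contribution of one multi-index to the squared Sobolev norm; by uniqueness
    of weak derivatives any representative computes it. *)
Definition derivative_energy alpha f : R :=
  \int[mu]_(x in D) (`|weakD D alpha f x| ^+ 2).

Lemma derivative_energyE alpha f v : weak_derivative D alpha f v ->
  derivative_energy alpha f = \int[mu]_(x in D) (v x ^+ 2).
Proof.
rewrite /derivative_energy => fv; have [fw wv] := weakDP fv.
have [_ [mv _] _] := fv; have [_ [mw _] _] := fw.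
apply: ae_eq_Rintegral => //.
- by apply: measurable_funX; exact: measurableT_comp.
- exact: measurable_funX.
- apply: filterS wv => x + Dx => /(_ Dx) ->.
  by rewrite -normrX ger0_norm// sqr_ge0.
Qed.

Lemma sobolev_norm_ge0 f : 0 <= N f.
Proof. exact: sqrtr_ge0. Qed.

Lemma derivative_energy_ge0 alpha f : 0 <= derivative_energy alpha f.
Proof. by apply: Rintegral_ge0 => x _; exact: exprn_ge0. Qed.

Lemma sobolev_norm_sqr f : N f ^+ 2 =
  \sum_(beta : {ffun 'I_d -> 'I_t.+1} | (multi_order (multi_index beta) <= t)%N)
    derivative_energy (multi_index beta) f.
Proof.
by rewrite sqr_sqrtr// sumr_ge0// => beta _; exact: derivative_energy_ge0.
Qed.

Lemma Rintegral_sqr_le_sobolev_norm alpha f v : (multi_order alpha <= t)%N ->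
  weak_derivative D alpha f v -> \int[mu]_(x in D) (v x ^+ 2) <= N f ^+ 2.
Proof.
move=> alphat fv; rewrite -(derivative_energyE fv) sobolev_norm_sqr.
have [beta betaE] := multi_indexP alphat; rewrite -betaE in alphat *.
rewrite (bigD1 beta)//= lerDl sumr_ge0// => i _.
exact: derivative_energy_ge0.
Qed.

(** Only the multi-index 0 matters: the weak derivative of order 0 is the function
    itself. *)
Lemma sobolev_norm_eq0 f : sobolev_function f -> N f = 0 ->
  {ae mu, forall x, domain_set D x -> f x = 0}.
Proof.
move=> Hf Nf; have [v fv v2] := Hf _ multi_order0.
have [lf [mv _] _] := fv.
have ff : weak_derivative D (fun=> 0%N) f f by exact: weak_derivative_order0.
have v0 : (\int[mu]_(x in D) `|(v x ^+ 2)%:E| = 0)%E.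
  have := Rintegral_sqr_le_sobolev_norm multi_order0 fv.
  rewrite Nf expr0n/= => I0.
  under eq_integral do rewrite /= ger0_norm ?sqr_ge0//.
  have fi : (\int[mu]_(x in D) (v x ^+ 2)%:E)%E \is a fin_num.
    exact: integrable_fin_num.
  rewrite -[LHS]fineK//; congr EFin; apply/eqP.
  rewrite eq_le I0 Rintegral_ge0//.
  by move=> x _; exact: sqr_ge0.
have /ae_eq_integral_abs v20 : measurable_fun D (fun x => (v x ^+ 2)%:E).
  by apply/measurable_EFinP; exact: measurable_funX.
have {v20}v0 := (v20 _ mD).1 v0.
have fvE := weak_derivative_unique ff fv.
apply: (filterS2 _ _ v0 fvE) => x + fvx Dx => /(_ Dx) /= [] /eqP.
by rewrite sqrf_eq0 fvx// => /eqP.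
Qed.

Lemma derivative_energyB_le alpha f g v w :
  weak_derivative D alpha f v -> square_integrable_on D v ->
  weak_derivative D alpha g w -> square_integrable_on D w ->
  derivative_energy alpha (f \- g) <=
  2 * (derivative_energy alpha f + derivative_energy alpha g).
Proof.
move=> fv v2 gw w2; have [_ [mv _] _] := fv; have [_ [mw _] _] := gw.
apply: (le_double_add (derivative_energyE (weak_derivativeB fv gw))
  (derivative_energyE fv) (derivative_energyE gw)).
have vw : mu.-integrable D (EFin \o (fun x => v x ^+ 2 + w x ^+ 2)).
  by have := integrableD mD v2 w2.
rewrite -(RintegralD mD v2 w2) -(RintegralZl _ mD vw).
apply: le_Rintegral => //.
- exact: (square_integrable_onB mv mw v2 w2).
- by have := integrableZl mD 2 vw.
- by move=> x _; exact: sqrB_le.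
Qed.

(** Consequence of (a - b)^2 <= 2 (a^2 + b^2), used as a substitute for the triangle
    inequality. *)
Lemma sobolev_normB_le f g : sobolev_function f -> sobolev_function g ->
  N (f \- g) ^+ 2 <= 2 * (N f ^+ 2 + N g ^+ 2).
Proof.
move=> Hf Hg; apply: (le_double_add (sobolev_norm_sqr (f \- g))
  (sobolev_norm_sqr f) (sobolev_norm_sqr g)).
rewrite -big_split/= mulr_sumr; apply: ler_sum => beta betat.
have [v fv v2] := Hf _ betat; have [w gw w2] := Hg _ betat.
exact: derivative_energyB_le fv v2 gw w2.
Qed.

Lemma sobolev_norm0_eq (u v : sobolev t D) : N (u \- v) = 0 -> u = v.
Proof.
have Huv := sobolev_functionB (sobolev_function_sobolev u)
  (sobolev_function_sobolev v).
move=> /(sobolev_norm_eq0 Huv) uv; apply/sobolev_eqP.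
by apply: filterS uv => x /[apply] /eqP; rewrite subr_eq0 => /eqP.
Qed.

End sobolev_norm_theory.

(** * Completeness of the Sobolev space *)

Section completeness.
Context {R : realType} {d : nat} (t : nat) (D : domain R d).
Local Notation mu :=
  (lebesgue_rV d : {sigma_finite_measure set 'rV[R]_d -> \bar R}).
Local Notation N := (sobolev_norm t D).
Implicit Types (f g v w : 'rV[R]_d -> R) (alpha : 'I_d -> nat).

Let mD : measurable (D : set 'rV[R]_d) := measurable_domain D.

Lemma sobolev_function_square_integrable f :
  sobolev_function t D f -> square_integrable_on D f.
Proof.
move=> /(_ _ (multi_order0 t)) [v fv v2]; have [lf [mv _] _] := fv.
have ff : weak_derivative D (fun=> 0%N) f f by exact: weak_derivative_order0.
have fvE := weak_derivative_unique ff fv.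
apply: (ae_square_integrable_on v2 lf.1).
by apply: filterS fvE => x fvx Dx; rewrite fvx.
Qed.

Lemma finite_norm_lebesgue_on f : measurable_fun [set: 'rV[R]_d] f ->
  square_integrable_on D f -> finite_norm (lebesgue_on D) 2%:E f.
Proof.
move=> mf /integrableP[_ f2]; rewrite /finite_norm unlock; apply: poweR_lty.
have mDC : measurable (~` (D : set 'rV[R]_d)) by exact: measurableC.
have mf2 : measurable_fun [set: 'rV[R]_d] (fun x => `|(f x)%:E| `^ 2)%E.
  apply: (measurableT_comp (measurable_poweR _)).
  by apply: measurableT_comp => //; exact/measurable_EFinP.
rewrite (ge0_negligible_integral (N := ~` D) mDC measurableT mf2)//; last 2 first.
- by move=> x _; exact: poweR_ge0.
- by rewrite /lebesgue_on/= /mrestr setICl; exact: measure0.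
rewrite setTD setCK (eq_measure_integral mu); last first.
  by move=> A mA AD; rewrite /lebesgue_on/= /mrestr (setIidl AD).
apply: le_lt_trans f2; rewrite le_eqVlt; apply/orP; left; apply/eqP.
apply: eq_integral => x _ /=; rewrite powR_mulrn//.
by rewrite -normrX.
Qed.

Lemma ae_lebesgue_on (P : 'rV[R]_d -> Prop) :
  {ae lebesgue_on D, forall x, P x} -> {ae mu, forall x, domain_set D x -> P x}.
Proof.
move=> [M [mM M0 PM]]; exists (M `&` D); split.
- exact: measurableI.
- exact: M0.
- by move=> x /not_implyP[Dx nPx]; split => //; exact: PM.
Qed.

(** Extending f by 0 outside D makes it measurable everywhere; its class for the
    restricted measure has a representative that agrees with f almost everywhere on
    D, and inherits its weak derivatives. *)
Lemma sobolev_of_function f : measurable_fun D f -> sobolev_function t D f ->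
  exists w : sobolev t D, {ae mu, forall x, domain_set D x -> w x = f x}.
Proof.
move=> mf Hf.
have mfD : measurable_fun [set: 'rV[R]_d] (f \_ D : _ -> measurableTypeR R).
  exact: (measurable_restrictT _ mD).1 mf.
pose fm :=
  isMeasurableFun.Build _ _ _ _ (f \_ D : _ -> measurableTypeR R) mfD.
pose F : {mfun 'rV[R]_d >-> measurableTypeR R} :=
  HB.pack (f \_ D : _ -> measurableTypeR R) fm.
pose w : {mfun_ (lebesgue_on D), 'rV[R]_d >-> measurableTypeR R} := (\pi F)%qT.
have wf : {ae mu, forall x, domain_set D x -> w x = f x}.
  have : ae_eq_op (lebesgue_on D) (repr w) F.
    by rewrite -eqmodE; apply/eqP; exact: reprK.
  move=> /asboolP /ae_lebesgue_on; apply: filterS => x + Dx => /(_ Dx I).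
  by rewrite /= /aqEqMfun_to_fun => ->; rewrite patchE mem_set.
have mw : measurable_fun [set: 'rV[R]_d] (w : _ -> R).
  exact: (measurable_funP (repr w)).
have Hw : sobolev_function t D w.
  move=> alpha /Hf[v fv v2]; exists v => //.
  apply: weak_derivative_ae fv; first exact: measurable_funTS.
  by apply: filterS wf => x wfx /wfx.
have nw : finite_norm (lebesgue_on D) 2%:E w.
  apply: finite_norm_lebesgue_on => //; exact: sobolev_function_square_integrable.
pose wm := isFinLebesgue.Build _ _ _ (lebesgue_on D) _ (lee1n 2) w nw.
pose W : LspaceType (lebesgue_on D) (lee1n 2) := HB.pack w wm.
by exists (@Sobolev _ _ t D W Hw).
Qed.

Lemma measurable_sobolev (u : sobolev t D) (A : set 'rV[R]_d) :
  measurable_fun A (u : 'rV[R]_d -> R).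
Proof.
apply: measurable_funTS.
exact: (measurable_funP (repr (sobolev_fun u : aeEqMfun _ _))).
Qed.

Lemma weakD_sobolev alpha f : sobolev_function t D f ->
  (multi_order alpha <= t)%N ->
  weak_derivative D alpha f (weakD D alpha f) /\
  square_integrable_on D (weakD D alpha f).
Proof.
move=> Hf /Hf[v fv v2]; have [fw wv] := weakDP fv; split => //.
have [_ [mw _] _] := fw; apply: (ae_square_integrable_on v2 mw).
by apply: filterS wv => x wvx Dx; rewrite wvx.
Qed.

Lemma square_integrable_on_dist f g h :
  measurable_fun D f -> measurable_fun D g -> measurable_fun D h ->
  square_integrable_on D f -> square_integrable_on D h ->
  {ae mu, forall x, domain_set D x -> `|f x - g x| <= h x} ->
  square_integrable_on D g.
Proof.
move=> mf mg mh f2 h2 fgh.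
have mg2 : measurable_fun D (fun x => (g x ^+ 2)%:E).
  by apply/measurable_EFinP; exact: measurable_funX.
have fh : mu.-integrable D (fun x => (2 * (f x ^+ 2 + h x ^+ 2))%:E).
  by have := integrableZl mD 2 (integrableD mD f2 h2).
apply/integrableP; split => //.
have /integrableP[mfh] := fh; apply: le_lt_trans.
apply: ae_ge0_le_integral => //.
- exact: measurableT_comp.
- exact: measurableT_comp.
- apply: filterS fgh => x /[apply] fgh.
  rewrite /= lee_fin ger0_norm ?sqr_ge0// ger0_norm; last first.
    by rewrite mulr_ge0// addr_ge0// sqr_ge0.
  rewrite -[g x](subKr (f x)) (le_trans (sqrB_le _ _))// ler_wpM2l// lerD2l.
  rewrite -[leLHS]ger0_norm ?sqr_ge0// normrX.
  by rewrite ler_sqr// nnegrE (le_trans _ fgh).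
Qed.

(** Each weak derivative of u_n, as a sequence in n, has geometrically decreasing
    steps in L^2, hence a limit.  The weak derivative of the limit of order 0 is the
    limit of the weak derivatives, so that the limit of order 0 belongs to the
    Sobolev space and is the limit of u_n in norm.  The ratio s^2 of the
    hypothesis becomes s in the conclusion because one factor s^n is spent on the
    weights of the L^2 argument. *)
Lemma sobolev_complete (u : nat -> sobolev t D) (C s : R) : 0 < s -> s < 1 ->
  (forall n, N (u n.+1 \- u n) <= C * (s ^+ 2) ^+ n) ->
  exists (w : sobolev t D) (K : R), forall n, N (u n \- w) <= K * s ^+ n.
Proof.
move=> s0 s1 uC.
have uH n := sobolev_function_sobolev (u n).
pose f (beta : {ffun 'I_d -> 'I_t.+1}) n := weakD D (multi_index beta) (u n).
have fP beta n : (multi_order (multi_index beta) <= t)%N ->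
    [/\ weak_derivative D (multi_index beta) (u n) (f beta n),
        measurable_fun D (f beta n) & square_integrable_on D (f beta n)].
  move=> betat; have [uf f2] := weakD_sobolev (uH n) betat.
  by have [_ []] := uf.
have /choice[gh ghP] beta : exists gh : ('rV[R]_d -> R) * ('rV[R]_d -> R),
    (multi_order (multi_index beta) <= t)%N ->
    [/\ measurable_fun D gh.1, measurable_fun D gh.2,
        square_integrable_on D gh.2 &
        {ae mu, forall x, domain_set D x ->
          forall n, `|f beta n x - gh.1 x| <= s ^+ n * gh.2 x}].
  have [betat|nbetat] := pselect (multi_order (multi_index beta) <= t)%N;
    last first.
    by exists (cst 0, cst 0).
  have mf n : measurable_fun D (f beta n) by have [] := fP beta n betat.
  have [] := @geometric_steps_L2 _ _ _ mu D (f beta) (C ^+ 2) s mD s0 s1 mf.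
    move=> n; have [uf _ f2] := fP beta n betat.
    have [uf' _ f2'] := fP beta n.+1 betat.
    have ff2 := square_integrable_onB (mf n.+1) (mf n) f2' f2.
    rewrite -[leLHS]fineK; last exact: (integrable_fin_num mD ff2).
    rewrite lee_fin.
    apply: (le_trans
      (Rintegral_sqr_le_sobolev_norm betat (weak_derivativeB uf' uf))).
    have -> : C ^+ 2 * s ^+ 4 ^+ n = (C * s ^+ 2 ^+ n) ^+ 2.
      by rewrite [RHS]exprMn -!exprM -mulnA (mulnC n 2) mulnA.
    apply: lerXn2r (uC n); rewrite nnegrE; first exact: sobolev_norm_ge0.
    exact: le_trans (sobolev_norm_ge0 _ _ _) (uC n).
  by move=> g [h ghP]; exists (g, h).
(* [b0] is the multi-index 0; the limit of its weak derivatives is the limit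
   function. *)
have [b0 b0E] := multi_indexP (@multi_order0 d t).
have b0t : (multi_order (multi_index b0) <= t)%N by rewrite b0E multi_order0.
have g2 beta : (multi_order (multi_index beta) <= t)%N ->
    square_integrable_on D (gh beta).1.
  move=> betat; have [_ mf f2] := fP beta 0%N betat.
  have [mg mh h2 fgh] := ghP beta betat.
  apply: (square_integrable_on_dist mf mg mh f2 h2).
  by apply: filterS fgh => x /[apply] /(_ 0%N); rewrite expr0 mul1r.
have ggP beta : (multi_order (multi_index beta) <= t)%N ->
    weak_derivative D (multi_index beta) (gh b0).1 (gh beta).1.
  move=> betat; have [mg0 mh0 h02 fgh0] := ghP b0 b0t.
  have [mg mh h2 fgh] := ghP beta betat.
  have li := square_integrable_locally_integrable_on.
  apply: (weak_derivative_cvg s0 s1 _ (li _ _ _ _ mg0 (g2 _ b0t))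
    (li _ _ _ _ mg (g2 _ betat)) (li _ _ _ _ mh0 h02) (li _ _ _ _ mh h2)
    fgh0 fgh) => n.
  have [uf0 mf0 _] := fP b0 n b0t; have [uf _ _] := fP beta n betat.
  apply: (weak_derivative_ae mf0 _ uf); apply: weak_derivative_unique (uf0).
  by rewrite b0E; apply: weak_derivative_order0 => //; have [] := uf0.
have [mg0 _ _ _] := ghP b0 b0t.
have Hg : sobolev_function t D (gh b0).1.
  move=> alpha alphat; have [beta betaE] := multi_indexP alphat.
  rewrite -betaE in alphat *; exists (gh beta).1; first exact: ggP.
  exact: g2.
have [w wg] := sobolev_of_function mg0 Hg; exists w.
exists (Num.sqrt (\sum_(beta : {ffun 'I_d -> 'I_t.+1} |
   (multi_order (multi_index beta) <= t)%N)
   \int[mu]_(x in D) ((gh beta).2 x ^+ 2))).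
move=> n; rewrite -ler_sqr ?nnegrE; last 2 first.
- exact: sobolev_norm_ge0.
- by rewrite mulr_ge0 ?sqrtr_ge0 ?exprn_ge0 ?(ltW s0).
rewrite sobolev_norm_sqr exprMn sqr_sqrtr; last first.
  by apply: sumr_ge0 => beta _; apply: Rintegral_ge0 => x _; exact: sqr_ge0.
rewrite mulr_suml; apply: ler_sum => beta betat.
have [uf mf f2] := fP beta n betat; have [mg mh h2 fgh] := ghP beta betat.
have wgP : weak_derivative D (multi_index beta) w (gh beta).1.
  apply: weak_derivative_ae (ggP _ betat); first exact: measurable_sobolev.
  by apply: filterS wg => x wgx /wgx.
rewrite (derivative_energyE (weak_derivativeB uf wgP)).
rewrite mulrC -(RintegralZl _ mD h2).
have i1 := square_integrable_onB mf mg f2 (g2 _ betat).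
have i2 : mu.-integrable D
    (EFin \o (fun x => (s ^+ n) ^+ 2 * (gh beta).2 x ^+ 2)).
  by have := integrableZl mD ((s ^+ n) ^+ 2) h2.
apply: fine_le; [exact: integrable_fin_num|exact: integrable_fin_num|].
apply: ae_ge0_le_integral => //.
- by move=> x _; rewrite lee_fin sqr_ge0.
- exact: measurable_int i1.
- by move=> x _; rewrite lee_fin mulr_ge0 ?sqr_ge0.
- exact: measurable_int i2.
- apply: filterS fgh => x /[apply] /(_ n) fgh.
  rewrite lee_fin -exprMn /= -[leLHS]ger0_norm ?sqr_ge0// normrX.
  by rewrite ler_sqr// nnegrE (le_trans _ fgh).
Qed.

End completeness.

(** * Contractions *)

Lemma geometric_le0 {R : realType} (a K s : R) : 0 < s -> s < 1 ->
  (forall n, a <= K * s ^+ n) -> a <= 0.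
Proof.
move=> s0 s1 aK.
have cK : geometric K s n @[n --> \oo] --> (0 : R).
  by apply: cvg_geometric; rewrite gtr0_norm.
rewrite -(cvg_lim (@Rhausdorff R) cK); apply: limr_ge.
  by apply/cvg_ex; exists 0.
exact: nearW.
Qed.

Section banach.
Context {R : realType} {T : Type} (dist : T -> T -> R).
Hypothesis dist_ge0 : forall x y, 0 <= dist x y.
Hypothesis dist_eq0 : forall x y, dist x y = 0 -> x = y.
Hypothesis dist_relaxed : forall x y z,
  dist x y ^+ 2 <= 2 * (dist z y ^+ 2 + dist z x ^+ 2).
Hypothesis dist_complete : forall (u : nat -> T) (C s : R), 0 < s -> s < 1 ->
  (forall n, dist (u n.+1) (u n) <= C * (s ^+ 2) ^+ n) ->
  exists w (K : R), forall n, dist (u n) w <= K * s ^+ n.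
Variables (f : T -> T) (q : R).
Hypotheses (q_gt0 : 0 < q) (q_lt1 : q < 1).
Hypothesis f_contraction : forall x y, dist (f x) (f y) <= q * dist x y.

Lemma contraction_iter x y n :
  dist (iter n f x) (iter n f y) <= q ^+ n * dist x y.
Proof.
elim: n => [|n ih]; first by rewrite mul1r.
rewrite !iterS exprS -mulrA (le_trans (f_contraction _ _))//.
by rewrite ler_wpM2l// ltW.
Qed.

Lemma contraction_fixed_point_unique x y : f x = x -> f y = y -> x = y.
Proof.
move=> fx fy; apply: dist_eq0; apply/eqP; rewrite eq_le dist_ge0 andbT.
have := f_contraction x y; rewrite fx fy -subr_le0 -{1}[dist x y]mul1r -mulrBl.
by rewrite pmulr_rle0// subr_gt0.
Qed.

(** The iterates u_n converge to some w.  Then f(w) is within K s^n of u_(n+1),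
    and so is w, whence dist (f w) w = 0 by the relaxed triangle inequality. *)
Lemma contraction_fixed_point (x0 : T) : exists w, f w = w.
Proof.
(* [dist_complete] is applied with the ratio s^2 = q. *)
pose s := Num.sqrt q; pose u n := iter n f x0.
have s0 : 0 < s by rewrite sqrtr_gt0.
have s1 : s < 1 by rewrite -sqrtr1 ltr_sqrt.
have s2 : s ^+ 2 = q by rewrite sqr_sqrtr// ltW.
have [n|w [K uw]] := dist_complete (u := u) (C := dist (f x0) x0) s0 s1.
  by rewrite /u iterSr s2 mulrC; exact: contraction_iter.
exists w; apply: dist_eq0.
suff : dist (f w) w ^+ 2 <= 0.
  by move=> dle0; apply/eqP; rewrite -sqrf_eq0 eq_le dle0 sqr_ge0.
apply: (@geometric_le0 _ _ (4 * K ^+ 2) (s ^+ 2)) => [||n].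
- by rewrite exprn_gt0.
- by rewrite expr_lt1// ltW.
rewrite (le_trans (dist_relaxed _ _ (u n.+1)))//.
have Ks0 : 0 <= K * s ^+ n by exact: le_trans (dist_ge0 _ _) (uw n).
have sqr_le y : dist (u n.+1) y <= K * s ^+ n ->
    dist (u n.+1) y ^+ 2 <= K ^+ 2 * s ^+ 2 ^+ n.
  by move=> dy; rewrite exprAC -exprMn ler_sqr// nnegrE.
have d1 : dist (u n.+1) w <= K * s ^+ n.
  by rewrite (le_trans (uw _))// exprS mulrCA ler_piMl// ltW.
have d2 : dist (u n.+1) (f w) <= K * s ^+ n.
  rewrite (le_trans (f_contraction _ _))//.
  rewrite (le_trans (ler_wpM2l (ltW q_gt0) (uw n)))//.
  by rewrite ler_piMl// ltW.
apply: le_trans (_ : 2 * (K ^+ 2 * s ^+ 2 ^+ n + K ^+ 2 * s ^+ 2 ^+ n) <= _).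
  by rewrite ler_wpM2l// lerD// sqr_le.
by rewrite -mulr2n -[X in 2 * X]mulr_natl !mulrA -natrM.
Qed.

(** Banach's fixed point theorem, from a relaxed triangle inequality and the
    convergence of sequences with geometrically decreasing steps. *)
Lemma banach_fixed_point_iter (x0 : T) : exists w,
  unique (fun x => f x = x) w /\
  forall x, (fun n => dist (iter n f x) w) @ \oo --> (0 : R) /\
    forall n, dist (iter n f x) w <= q ^+ n * dist x w.
Proof.
have [w fw] := contraction_fixed_point x0; exists w; split.
  by split=> // y fy; exact: contraction_fixed_point_unique.
move=> x.
have bound n : dist (iter n f x) w <= q ^+ n * dist x w.
  by rewrite -{1}(iter_fix n fw); exact: contraction_iter.
split=> //; apply: (@squeeze_cvgr _ _ _ _ (cst 0) (geometric (dist x w) q)).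
- by apply: nearW => n; rewrite dist_ge0/= mulrC.
- exact: cvg_cst.
- by apply: cvg_geometric; rewrite gtr0_norm.
Qed.

End banach.

(** * Contractions of the Sobolev space *)

Section sobolev_metric.
Context {R : realType} {d : nat} (t : nat) (D : domain R d).

(** x - y is the difference of z - y and z - x. *)
Lemma sobolev_norm_relaxed_triangle (x y z : sobolev t D) :
  sobolev_norm t D (x \- y) ^+ 2 <=
  2 * (sobolev_norm t D (z \- y) ^+ 2 + sobolev_norm t D (z \- x) ^+ 2).
Proof.
have H := @sobolev_function_sobolev R d t D.
have E : (z \- y) \- (z \- x) = x \- y :> ('rV[R]_d -> R).
  by apply/funext => p /=; rewrite opprB addrC addrA subrK.
exact: (eq_ind _ (fun h => sobolev_norm t D h ^+ 2 <= _) (sobolev_normB_le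
  (sobolev_functionB (H z) (H y)) (sobolev_functionB (H z) (H x))) _ E).
Qed.

Lemma sobolev_inhabited : inhabited (sobolev t D).
Proof.
have z2 : square_integrable_on D (cst 0 : 'rV[R]_d -> R).
  rewrite /square_integrable_on (_ : EFin \o _ = cst 0%E).
    exact: integrable0.
  by apply/funext => x; rewrite /= expr0n.
have H0 : sobolev_function t D (cst 0).
  move=> alpha _; exists (cst 0) => //.
  have l0 : locally_integrable_on D (cst 0 : 'rV[R]_d -> R).
    exact: square_integrable_locally_integrable_on.
  split => // phi _.
  under eq_Rintegral do rewrite mul0r.
  under [in RHS]eq_Rintegral do rewrite mul0r.
  by rewrite /Rintegral integral0 mulr0.
have [w _] := sobolev_of_function (@measurable_cst _ _ _ _ D (0 : R)) H0.
by constructor.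
Qed.

End sobolev_metric.

Theorem theorem3p6 (R : realType) (d t : nat) (D : domain R d)
    (Theta : Type) (G : Theta -> sobolev t D -> sobolev t D) (theta : Theta)
    (q : R) (q_gt0 : 0 < q) (q_lt1 : q < 1)
    (G_contraction : forall u v : sobolev t D,
      sobolev_norm t D (G theta u \- G theta v) <=
      q * sobolev_norm t D (u \- v)) :
  exists ustar : sobolev t D,
    unique (fun w => G theta w = w) ustar /\
    forall u : sobolev t D,
      (fun n => sobolev_norm t D (iter n (G theta) u \- ustar)) @ \oo --> (0 : R)
      /\ forall n : nat,
        sobolev_norm t D (iter n (G theta) u \- ustar) <=
        q ^+ n * sobolev_norm t D (u \- ustar).
Proof.
have [u0] := sobolev_inhabited t D.
exact: (banach_fixed_point_iter
  (dist := fun u v : sobolev t D => sobolev_norm t D (u \- v))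
  (fun u v => sobolev_norm_ge0 t D (u \- v)) (@sobolev_norm0_eq R d t D)
  (@sobolev_norm_relaxed_triangle R d t D) (@sobolev_complete R d t D)
  q_gt0 q_lt1 G_contraction u0).
Qed.
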